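(* Let $F$ be a properly parametrized Markov multi-map of $[0,1]$ with forward trajectory system $(X,T)$ and associated shift of finite type $\Sigma_M$. (1) If $(X,T)$ is topologically mixing, then $\Sigma_M$ satisfies the Mixing Condition (MC). (2) If $\Sigma_M$ satisfies the Coding Condition (CC) and the Mixing Condition (MC), then $(X,T)$ is topologically mixing and its periodic points are dense in $X$.
   Context: **Markov multi-maps.** $2^{[0,1]}$ denotes the set of closed subsets of $[0,1]$. A Markov multi-map of $[0,1]$ is given by a tuple $F=(P,\mathcal{A}_0,\mathcal{A}_1,\mathcal{A}_2,D,R,\{f_a\}_{a\in\mathcal{A}_0})$ such that: (1) $P=\{p_0,\dots,p_r\}$ with $0=p_0<\dots<p_r=1$; (2) $\mathcal{A}=\mathcal{A}_0\sqcup\mathcal{A}_1\sqcup\mathcal{A}_2$ is a finite set; (3) $D:\mathcal{A}\to 2^{[0,1]}$, and for each $a\in\mathcal{A}$ there is $p_i\in P$ with $D(a)=[p_i,p_{i+1}]$ if $a\in\mathcal{A}_0$ and $D(a)=\{p_i\}$ if $a\in\mathcal{A}_1\cup\mathcal{A}_2$; (4) $R:\mathcal{A}\to 2^{[0,1]}$, and for each $a\in\mathcal{A}$ there are $u\le v$ in $P$ with $R(a)=[u,v]$, where $u<v$ if $a\in\mathcal{A}_0$; $u<v$ and $R(a)\cap P=\{u,v\}$ if $a\in\mathcal{A}_1$; $u=v$ if $a\in\mathcal{A}_2$; (5) for each $a\in\mathcal{A}_0$, $f_a:D(a)\to R(a)$ is a homeomorphism; (6) $[0,1]=\bigcup_{a\in\mathcal{A}}D(a)$.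 For $a\in\mathcal{A}_0$ let $G(a)$ be the graph of $f_a$; for $a\in\mathcal{A}_1\cup\mathcal{A}_2$ let $G(a)=D(a)\times R(a)$. The multi-map $F:[0,1]\to 2^{[0,1]}$ has graph $G(F)=\bigcup_{a\in\mathcal{A}}G(a)$, i.e. $y\in F(x)$ iff $(x,y)\in G(F)$. If $a\in\mathcal{A}_0$ with $D(a)=[p_i,p_{i+1}]$, $R(a)=[u,v]$: $D_0(a)=(p_i,p_{i+1})$, $R_0(a)=(u,v)$, $G_0(a)$ = graph of $f_a|_{D_0(a)}$. If $a\in\mathcal{A}_1$ with $D(a)=\{p\}$, $R(a)=[u,v]$: $D_0(a)=\{p\}$, $R_0(a)=(u,v)$, $G_0(a)=\{p\}\times(u,v)$. If $a\in\mathcal{A}_2$ with $D(a)=\{p\}$, $R(a)=\{q\}$: $D_0(a)=\{p\}$, $R_0(a)=\{q\}$, $G_0(a)=\{(p,q)\}$. $F$ is properly parametrized if $\{G_0(a):a\in\mathcal{A}\}$ is a partition of $G(F)$. **Trajectories.** $X=\{x\in[0,1]^{\mathbb{Z}_{\ge0}}:x_{k+1}\in F(x_k)\ \forall k\ge0\}$ with the subspace topology of the product topology, and $T:X\to X$, $T(x)_k=x_{k+1}$. For $n\ge 1$, $X_n=\{(x_0,\dots,x_{n-1})\in[0,1]^n:(x_i,x_{i+1})\in G(F),\ 0\le i\le n-2\}$ with the subspace topology. A system $(X,T)$ is topologically mixing if for all nonempty open $U,V\subset X$ there is $N\ge0$ with $T^n(U)\cap V\ne\emptyset$ for all $n\ge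 N$; a point $x$ is periodic if $T^p(x)=x$ for some $p\ge1$. **Associated SFT.** $M(a,b)=1$ if $D_0(b)\subset R_0(a)$ and $M(a,b)=0$ otherwise ($a,b\in\mathcal{A}$). $\Sigma_M=\{\mathbf{a}\in\mathcal{A}^{\mathbb{Z}_{\ge0}}:M(a_n,a_{n+1})=1\ \forall n\ge 0\}$, with left shift $\sigma$. For $Z\subset\Sigma_M$, $\mathcal{L}_n(Z)$ is the set of words of length $n$ appearing in points of $Z$, $\mathcal{L}(Z)=\bigcup_n\mathcal{L}_n(Z)$; $\mathcal{L}_n=\mathcal{L}_n(\Sigma_M)$, $\mathcal{L}=\mathcal{L}(\Sigma_M)$. For $\mathcal{C}\subset\mathcal{A}$, $\Sigma_M(\mathcal{C})$ is the set of points of $\Sigma_M$ using only symbols of $\mathcal{C}$, and $\mathcal{L}_n(\mathcal{C})=\mathcal{L}_n(\Sigma_M(\mathcal{C}))$. A subshift $Z\subset\Sigma_M$ is a closed set with $\sigma(Z)\subset Z$; it is transitive on symbols if for all $a,b\in\mathcal{L}_1(Z)$ some word in $\mathcal{L}(Z)$ starts with $a$ and ends with $b$. **Inverse functions.** For $a\in\mathcal{A}_0$, $g_a=f_a^{-1}$; for $a\in\mathcal{A}_1\cup\mathcal{A}_2$, $g_a:R(a)\to D(a)$ is the constant map. For $u=u_0\cdots u_n\in\mathcal{L}$, $g_u=g_{u_0}\circ\cdots\circ g_{u_n}$ (defined on $R(u_n)$) and $I_u=g_u(R(u_n))$. For a possibly degenerate interval, $\ell([p,q])=q-p$. **Coding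 Condition (CC).** There is a subshift $Z\subset\Sigma_M$, transitive on symbols, such that (i) for every $y\in[0,1]$ there are $\mathbf{a}\in Z$ and $x\in X$ with $x_0=y$ and $(x_i,x_{i+1})\in G(a_i)$ for all $i\ge0$; and (ii) $\lim_{n\to\infty}\max_{u\in\mathcal{L}_n(Z)}\ell(I_u)=0$. **Essential symbols.** A word $u=u_0\cdots u_{n-1}\in\mathcal{L}_n$ is essential if $\{x\in X_{n+1}:(x_k,x_{k+1})\in G_0(u_k),\ 0\le k\le n-1\}$ is open in $X_{n+1}$. A symbol is essential if it appears in some essential word; $\mathcal{A}^{(e)}$ is the set of essential symbols. **Mixing Condition (MC).** A set $\mathcal{C}\subset\mathcal{A}$ is mixing if there is $N\ge1$ such that for all $a,b\in\mathcal{C}$ and all $n\ge N$ there is a word in $\mathcal{L}_n(\mathcal{C})$ beginning with $a$ and ending with $b$; a mixing component is a maximal mixing subset of $\mathcal{A}$. $\Sigma_M$ satisfies (MC) if there is a mixing component $\mathcal{C}\subset\mathcal{A}$ with $\mathcal{A}^{(e)}\subset\mathcal{C}$. *)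

(* Defs.v *)
From HB Require Import structures.
From mathcomp Require Import all_boot all_order all_algebra.
From mathcomp Require Import all_classical all_reals all_analysis.

Set Implicit Arguments.
Unset Strict Implicit.
Unset Printing Implicit Defensive.

Import Order.TTheory GRing.Theory Num.Theory.
Import numFieldNormedType.Exports.

Local Open Scope classical_set_scope.
Local Open Scope ring_scope.

Definition topologically_mixing (X : topologicalType) (T : X -> X) : Prop :=
  forall U V : set X, open U -> U !=set0 -> open V -> V !=set0 ->
    exists N : nat, forall n : nat, (N <= n)%N ->
      (iter n T @` U) `&` V !=set0.

Definition periodic_points (X : Type) (T : X -> X) : set X :=
  [set x | exists2 p : nat, (1 <= p)%N & iter p T x = x].

Section Symbolic.
Variable A : finType.

Definition full_shift := {ptws nat -> discrete_topology A}.

Definition shift (z : full_shift) : full_shift := fun n => z n.+1.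

Definition words (Z : set full_shift) (n : nat) : set (n.-tuple A) :=
  [set u | exists2 z, Z z &
    exists k : nat, forall i : 'I_n, tnth u i = z (k + i)%N].

Definition language (Z : set full_shift) : set (seq A) :=
  \bigcup_n (@tval n A @` @words Z n).

Definition begins_ends (w : seq A) (a b : A) : Prop :=
  exists s : seq A, w = a :: s /\ last a s = b.

Definition is_subshift (S Z : set full_shift) : Prop :=
  [/\ Z `<=` S, closed Z & shift @` Z `<=` Z].

Definition transitive_on_symbols (Z : set full_shift) : Prop :=
  forall a b : A, words Z [tuple a] -> words Z [tuple b] ->
    exists2 w : seq A, language Z w & begins_ends w a b.

Definition restrict_symbols (S : set full_shift) (C : set A)
    : set full_shift :=
  S `&` [set z | forall n, C (z n)].

Definition mixing_symbols (S : set full_shift) (C : set A) : Prop :=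
  exists2 N : nat, (1 <= N)%N &
    forall a b : A, C a -> C b -> forall n : nat, (N <= n)%N ->
      exists2 w : n.-tuple A,
        words (restrict_symbols S C) w & begins_ends w a b.

Definition mixing_component (S : set full_shift) (C : set A) : Prop :=
  mixing_symbols S C /\
  forall C' : set A, mixing_symbols S C' -> C `<=` C' -> C' = C.

End Symbolic.

Section Homeomorphism.
Variable R : realType.

Definition inverse_on (A : set R) (f : R -> R) : R -> R :=
  'pinv_(fun=> 0) A f.

Definition homeomorphism_between (A B : set R) (f : R -> R) : Prop :=
  [/\ set_bij A B f,
      {within A, continuous f} &
      {within B, continuous (inverse_on A f)}].

End Homeomorphism.

(** [Graph], [Vertical] and [Point] are the classes A_0, A_1 and A_2. *)
Variant symbol_class := Graph | Vertical | Point.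

(** The intervals D(a) and R(a) are given by the indices in P of their
    endpoints; an interval [p, p] is the singleton {p}. *)
Record markov_multimap (R : realType) := MarkovMultimap {
  mm_r : nat;
  mm_p : 'I_mm_r.+1 -> R;
  mm_p_first : mm_p ord0 = 0;
  mm_p_last : mm_p ord_max = 1;
  mm_p_incr : forall i j : 'I_mm_r.+1, (i < j)%N -> mm_p i < mm_p j;
  mm_symbol : finType;
  mm_class : mm_symbol -> symbol_class;
  mm_dl : mm_symbol -> 'I_mm_r.+1;
  mm_dr : mm_symbol -> 'I_mm_r.+1;
  mm_D_spec : forall a,
    match mm_class a with
    | Graph => mm_dr a = (mm_dl a).+1 :> nat
    | Vertical | Point => mm_dr a = mm_dl a
    end;
  mm_rl : mm_symbol -> 'I_mm_r.+1;
  mm_rr : mm_symbol -> 'I_mm_r.+1;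
  mm_R_spec : forall a,
    match mm_class a return Prop with
    | Graph => mm_p (mm_rl a) < mm_p (mm_rr a)
    | Vertical => mm_p (mm_rl a) < mm_p (mm_rr a) /\
        `[mm_p (mm_rl a), mm_p (mm_rr a)]%classic `&` range mm_p =
          [set mm_p (mm_rl a); mm_p (mm_rr a)]
    | Point => mm_rl a = mm_rr a
    end;
  (* only relevant on D(a), for symbols a of class Graph *)
  mm_f : mm_symbol -> R -> R;
  mm_f_homeo : forall a, mm_class a = Graph ->
    homeomorphism_between
      `[mm_p (mm_dl a), mm_p (mm_dr a)]%classic
      `[mm_p (mm_rl a), mm_p (mm_rr a)]%classic
      (mm_f a);
  mm_cover : `[0, 1]%classic =
    \bigcup_a `[mm_p (mm_dl a), mm_p (mm_dr a)]%classic
}.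

Section MarkovMultimap.
Variables (R : realType) (F : markov_multimap R).
Local Notation A := (mm_symbol F).
Implicit Types (a b : A).

Local Notation p := (@mm_p R F).

Definition mm_D a : set R := `[p (mm_dl a), p (mm_dr a)]%classic.

Definition mm_R a : set R := `[p (mm_rl a), p (mm_rr a)]%classic.

Definition mm_D0 a : set R :=
  match mm_class a with
  | Graph => `]p (mm_dl a), p (mm_dr a)[%classic
  | Vertical | Point => [set p (mm_dl a)]
  end.

Definition mm_R0 a : set R :=
  match mm_class a with
  | Graph | Vertical => `]p (mm_rl a), p (mm_rr a)[%classic
  | Point => [set p (mm_rl a)]
  end.

Definition mm_G a : set (R * R) :=
  match mm_class a with
  | Graph => [set xy | mm_D a xy.1 /\ xy.2 = mm_f a xy.1]
  | Vertical | Point => mm_D a `*` mm_R a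
  end.

Definition mm_G0 a : set (R * R) :=
  match mm_class a with
  | Graph => [set xy | mm_D0 a xy.1 /\ xy.2 = mm_f a xy.1]
  | Vertical | Point => mm_D0 a `*` mm_R0 a
  end.

Definition mm_graph : set (R * R) := \bigcup_a mm_G a.

Definition mm_map (x : R) : set R := [set y | mm_graph (x, y)].

(** The set of sets {G_0(a) : a in A} is a partition; two symbols with the
    same G_0 are not excluded. *)
Definition properly_parametrized : Prop :=
  partition (range mm_G0) id mm_graph.

Definition trajectories : set {ptws nat -> R} :=
  [set x | (forall k, `[0, 1]%classic (x k)) /\
           (forall k, mm_map (x k) (x k.+1))].

(** [set_type] carries the subspace topology. *)
Definition trajectory_space : topologicalType := set_type trajectories.

Lemma trajectories_shift (x : trajectory_space) :
  (fun k => set_val x k.+1 : R) \in trajectories.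
Proof.
have [x01 xF] := set_mem (valP x).
by apply/mem_set; split=> k; [exact: x01|exact: xF].
Qed.

Definition trajectory_map (x : trajectory_space) : trajectory_space :=
  exist (fun y => y \in trajectories) _ (trajectories_shift x).

Definition finite_trajectories (n : nat) : set {ptws 'I_n -> R} :=
  [set x | (forall i, `[0, 1]%classic (x i)) /\
           (forall i j : 'I_n, j = i.+1 :> nat -> mm_graph (x i, x j))].

Definition finite_trajectory_space (n : nat) : topologicalType :=
  set_type (@finite_trajectories n).

Definition transition a b : nat :=
  if `[< mm_D0 b `<=` mm_R0 a >] then 1%N else 0%N.

Definition sft : set (full_shift A) :=
  [set z | forall n, transition (z n) (z n.+1) = 1%N].

Definition inverse_branch a : R -> R :=
  match mm_class a with
  | Graph => inverse_on (mm_D a) (mm_f a)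
  | Vertical | Point => fun=> p (mm_dl a)
  end.

Definition inverse_word (u : seq A) : R -> R :=
  foldr (fun a h => inverse_branch a \o h) id u.

Definition inverse_interval (u : seq A) : set R :=
  if u is a :: s then inverse_word u @` mm_R (last a s) else set0.

(** For a closed interval [q, q'], this is q' - q. *)
Definition interval_length (I : set R) : R := sup I - inf I.

Definition coding_condition : Prop :=
  exists Z : set (full_shift A),
    [/\ is_subshift sft Z,
        transitive_on_symbols Z,
        forall y : R, `[0, 1]%classic y ->
          exists2 z, Z z & exists x : trajectory_space,
            set_val x 0%N = y /\
            forall i, mm_G (z i) (set_val x i, set_val x i.+1) &
        \big[Num.max/0]_(u : n.-tuple A | `[< words Z u >])
          interval_length (inverse_interval u) @[n --> \oo] --> (0 : R)].

Definition essential_word (n : nat) (u : n.-tuple A) : Prop :=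
  words sft u /\
  open [set x : finite_trajectory_space n.+1 | forall k : 'I_n,
    mm_G0 (tnth u k)
      (set_val x (widen_ord (leqnSn n) k), set_val x (lift ord0 k))].

Definition essential_symbols : set A :=
  [set a | exists n : nat, exists2 u : n.-tuple A,
    essential_word u & a \in u].

Definition mixing_condition : Prop :=
  exists2 C : set A, mixing_component sft C & essential_symbols `<=` C.

End MarkovMultimap.

(* Main.v *)
(* The inverse branches parametrize the trajectories of length n coded by an
   admissible word by their last coordinate, so they form an open arc, or a
   single point when the last symbol is a point.  A trajectory in an arc cannot
   lie in the closure of another cell: being on the boundary of a cell at one
   time forces the trajectory to stay in P and on the boundary at all later
   times, whereas P is avoided by the last step of an arc.  Hence every word
   whose last symbol is not a point is essential.

   If X is mixing, the open cells of two essential words are connected by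
   trajectories of every large length, and the symbols lying on a path between
   essential symbols form a mixing set.  Conversely, under (CC) and (MC) every
   nonempty open set contains all trajectories that follow some finite word in
   the symbols of the mixing component.  Two such words are joined into a cycle
   with a prescribed large delay, and the intermediate value theorem applied to
   the composition of inverse branches along the cycle yields a periodic
   trajectory following it. *)
Require Import Defs.
From mathcomp Require Import all_boot all_order all_algebra.
From mathcomp Require Import all_classical all_reals all_analysis.
From mathcomp Require Import lra zify.

Set Implicit Arguments.
Unset Strict Implicit.
Unset Printing Implicit Defensive.

Import Order.TTheory GRing.Theory Num.Theory.
Import numFieldNormedType.Exports.

Local Open Scope classical_set_scope.
Local Open Scope ring_scope.

(** * Bijections between segments and their interiors *)

Lemma segment_bij_interior (R : realType) (f : R -> R) (a b u v : R) :
  a < b -> set_bij `[a, b]%classic `[u, v]%classic f ->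
  {within `[a, b]%classic, continuous f} ->
  {in `[a, b], forall x, (x \in `]a, b[) = (f x \in `]u, v[)}.
Proof.
move=> ab [fun_f inj_f surj_f] fc x xab.
have fI : {in `[a, b] &, injective f}.
  by move=> s t sI tI; apply: inj_f; apply/mem_set.
have fR y : y \in `[a, b] -> u <= f y <= v.
  by move=> yI; have := fun_f y yI; rewrite /= in_itv.
have aI : a \in `[a, b] by rewrite in_itv /= lexx ltW.
have bI : b \in `[a, b] by rewrite in_itv /= lexx ltW.
have uv : u <= v by have /andP[] := fR _ aI; exact: le_trans.
have [s sI fs] : exists2 s, s \in `[a, b] & f s = u.
  by have [|s] := surj_f u; [rewrite /= in_itv /= lexx uv|exists s].
have [t tI ft] : exists2 t, t \in `[a, b] & f t = v.
  by have [|t] := surj_f v; [rewrite /= in_itv /= lexx uv|exists t].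
have := xab; have := sI; have := tI; rewrite !in_itv /= => tI' sI' xI'.
have fx := fR _ xab; have fa := fR _ aI; have fb := fR _ bI.
(* A continuous injection on a segment is strictly monotone. If the preimage of [u] or [v] were not
   the matching endpoint, the value of [f] at that endpoint would leave [[u, v]]. *)
have endp (c : R) : c \in `[a, b] -> (c = a \/ c = b) -> f c = u \/ f c = v.
  have [m|m] := itv_continuous_inj_mono fc fI; move=> cI cE.
  - case: cE => ->; [left|right].
    + have [sa|/eqP] := eqVneq s a; first by rewrite -sa.
      move=> sna; have : f a < f s by apply: m => //; lra.
      by rewrite fs; lra.
    + have [sa|/eqP] := eqVneq t b; first by rewrite -sa.
      move=> sna; have : f t < f b by apply: m => //; lra.
      by rewrite ft; lra.
  - case: cE => ->; [right|left].
    + have [sa|/eqP] := eqVneq t a; first by rewrite -sa.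
      move=> sna; have : f t < f a by apply: m => //; lra.
      by rewrite ft; lra.
    + have [sa|/eqP] := eqVneq s b; first by rewrite -sa.
      move=> sna; have : f b < f s by apply: m => //; lra.
      by rewrite fs; lra.
apply/idP/idP => [|].
  move=> xi; have [m|m] := itv_continuous_inj_mono fc fI.
  - have ? : f a < f x by apply: m => //; lra.
    have ? : f x < f b by apply: m => //; lra.
    lra.
  - have ? : f x < f a by apply: m => //; lra.
    have ? : f b < f x by apply: m => //; lra.
    lra.
move=> fi; have [xa|/eqP xa] := eqVneq x a.
  by case: (endp x xab (or_introl xa)) => fE; lra.
have [xb|/eqP xb] := eqVneq x b.
  by case: (endp x xab (or_intror xb)) => fE; lra.
lra.
Qed.

(** * Branches and cells *)

Section Geometry.
Variables (R : realType) (F : markov_multimap R).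
Local Notation A := (mm_symbol F).
Local Notation p := (@mm_p R F).
Local Notation D := (@mm_D R F).
Local Notation D0 := (@mm_D0 R F).
Local Notation R' := (@mm_R R F).
Local Notation R0 := (@mm_R0 R F).
Local Notation G := (@mm_G R F).
Local Notation G0 := (@mm_G0 R F).
Implicit Types (a b : A) (x y : R) (i j : 'I_(mm_r F).+1).

Lemma mm_p_le i j : (i <= j)%N -> p i <= p j.
Proof.
rewrite leq_eqVlt => /orP[/eqP/val_inj ->//|/mm_p_incr /ltW //].
Qed.

Lemma mm_p_lt i j : p i < p j -> (i < j)%N.
Proof. by move=> ij; rewrite ltnNge; apply/negP => /mm_p_le; rewrite leNgt ij. Qed.

Lemma mm_p01 i : 0 <= p i <= 1.
Proof.
by rewrite -(mm_p_first F) -(mm_p_last F) !mm_p_le// -ltnS.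
Qed.

Lemma mm_dl_dr a : mm_class a = Graph -> p (mm_dl a) < p (mm_dr a).
Proof.
by move=> ca; apply: mm_p_incr; have := mm_D_spec a; rewrite ca => ->.
Qed.

Lemma mm_rl_rr a : p (mm_rl a) <= p (mm_rr a).
Proof.
have := mm_R_spec a; case: (mm_class a) => [/ltW //|[/ltW //]|->//].
Qed.

Lemma mm_R0_sub a : R0 a `<=` R' a.
Proof.
move=> y; rewrite /mm_R0 /mm_R.
case: (mm_class a) => /=; rewrite ?in_itv /=; [lra|lra|move=> ->].
by rewrite lexx mm_rl_rr.
Qed.

Lemma mm_D0_sub a : D0 a `<=` D a.
Proof.
move=> y; rewrite /mm_D0 /mm_D; have := mm_D_spec a.
case: (mm_class a) => /=; rewrite ?in_itv /=; [lra| |]; move=> -> ->;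
by rewrite lexx.
Qed.

Lemma mm_D_sub01 a x : D a x -> 0 <= x <= 1.
Proof.
rewrite /mm_D /= in_itv /=.
have := mm_p01 (mm_dl a); have := mm_p01 (mm_dr a); lra.
Qed.

Lemma mm_R_sub01 a x : R' a x -> 0 <= x <= 1.
Proof.
rewrite /mm_R /= in_itv /=.
have := mm_p01 (mm_rl a); have := mm_p01 (mm_rr a); lra.
Qed.

Lemma mm_R0_neq0 a : exists y, R0 a y.
Proof.
have := mm_R_spec a; rewrite /mm_R0; case: (mm_class a) => /=.
- by move=> ?; exists ((p (mm_rl a) + p (mm_rr a)) / 2); rewrite in_itv /=; lra.
- by move=> [? _]; exists ((p (mm_rl a) + p (mm_rr a)) / 2); rewrite in_itv /=; lra.
- by move=> _; exists (p (mm_rl a)).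
Qed.

Lemma mm_D0_neq0 a : exists y, D0 a y.
Proof.
have := @mm_dl_dr a; rewrite /mm_D0; case: (mm_class a) => /=.
- move=> /(_ erefl) ?; exists ((p (mm_dl a) + p (mm_dr a)) / 2).
  by rewrite in_itv /=; lra.
- by move=> _; exists (p (mm_dl a)).
- by move=> _; exists (p (mm_dl a)).
Qed.

Lemma mm_D0_graphN a i : mm_class a = Graph -> ~ D0 a (p i).
Proof.
move=> ca; have := mm_D_spec a; rewrite /mm_D0 ca /= in_itv /= => E.
by move=> /andP[/mm_p_lt + /mm_p_lt]; rewrite E ltnS => /leq_trans/[apply]; rewrite ltnn.
Qed.

Lemma mm_R0_verticalN a i : mm_class a = Vertical -> ~ R0 a (p i).
Proof.
move=> ca; have := mm_R_spec a; rewrite /mm_R0 ca /= in_itv /= => -[uv E] i_uv.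
have : [set p (mm_rl a); p (mm_rr a)]%classic (p i).
  by rewrite -E; split; [rewrite /= in_itv /=; lra|exists i].
by case=> /=; lra.
Qed.

(** The Markov property: [D0 b] is a point of P or a gap between consecutive points of P, while
    [R0 a] has its ends in P, so one common point forces inclusion. Admissibility of a transition
    can thus be read off a single trajectory. *)
Lemma mm_meet a b y : R0 a y -> D0 b y -> D0 b `<=` R0 a /\ D b `<=` R' a.
Proof.
move=> ay byy.
suff [h1 [h2 h3]] : [/\ p (mm_rl a) <= p (mm_dl b),
  p (mm_dr b) <= p (mm_rr a) & D0 b `<=` R0 a].
  by split => // x; rewrite /mm_D /mm_R /= !in_itv /=; lra.
have := mm_R_spec a; have := mm_D_spec b; move: ay byy.
rewrite /mm_R0 /mm_D0; case ca: (mm_class a); case cb: (mm_class b) => /=;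
  rewrite ?in_itv /=.
all: try by move=> + E -> _; rewrite E => ?; split; [lra|lra|move=> x /= ->; rewrite in_itv].
all: try by move=> E1 E2 -> <-; rewrite -E1 -E2; split.
- move=> /andP[y1 y2] /andP[y3 y4] E _.
  have := mm_p_lt (lt_trans y1 y4); have := mm_p_lt (lt_trans y3 y2).
  rewrite E ltnS -E => /mm_p_le h1 /mm_p_le h2; split => // x /=; rewrite !in_itv /=; lra.
- move=> /andP[y1 y2] /andP[y3 y4] E _.
  have := mm_p_lt (lt_trans y1 y4); have := mm_p_lt (lt_trans y3 y2).
  rewrite E ltnS -E => /mm_p_le h1 /mm_p_le h2; split => // x /=; rewrite !in_itv /=; lra.
- move=> -> h; exfalso; have := @mm_D0_graphN b (mm_rl a) cb.
  by rewrite /mm_D0 cb /= in_itv /=; apply.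
Qed.

(* Precomposing with the retraction onto R(a) turns the inverse branch into a
   function that is continuous on the whole line. *)
Definition clamp_branch a y :=
  inverse_branch a (Num.max (p (mm_rl a)) (Num.min (p (mm_rr a)) y)).
Local Notation h := clamp_branch.

Lemma clamp_branchE a y : R' a y -> h a y = inverse_branch a y.
Proof.
rewrite /mm_R /= in_itv /= /h => /andP[yl yr].
by rewrite (min_idPr yr) (max_idPr yl).
Qed.

Lemma mm_f_bij a x : mm_class a = Graph -> D a x ->
  R' a (mm_f a x) /\ inverse_branch a (mm_f a x) = x.
Proof.
move=> ca; case: (mm_f_homeo ca) => -[fun_f inj_f surj_f] _ _ ax.
split; first exact: fun_f.
by rewrite /inverse_branch ca /inverse_on pinvKV// inE.
Qed.

Lemma inverse_branch_bij a y : mm_class a = Graph -> R' a y ->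
  D a (inverse_branch a y) /\ mm_f a (inverse_branch a y) = y.
Proof.
move=> ca ay; case: (mm_f_homeo ca) => -[fun_f inj_f surj_f] _ _.
have [x ax xy] := surj_f _ ay.
have [_ E] := mm_f_bij ca ax.
by rewrite -xy E.
Qed.

(** Read from the second coordinate, the three classes become one: even a vertical cell is the graph
    of a (constant) function of [y]. Later arguments need no case analysis on the class. *)
Lemma mm_GP a x y : G a (x, y) <-> R' a y /\ x = h a y.
Proof.
rewrite /mm_G; case ca: (mm_class a) => /=.
- split=> [[ax ->]|[ay ->]].
    by have [ay E] := mm_f_bij ca ax; rewrite clamp_branchE // E.
  by rewrite clamp_branchE //; have [? ->] := inverse_branch_bij ca ay.
- rewrite /mm_D /h /inverse_branch ca /=; have := mm_D_spec a; rewrite ca => -> /=.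
  rewrite in_itv /=; split=> [[xd ?]|[? ->]]; split => //; last by rewrite lexx.
  by apply/eqP; rewrite eq_le andbC.
- rewrite /mm_D /h /inverse_branch ca /=; have := mm_D_spec a; rewrite ca => -> /=.
  rewrite in_itv /=; split=> [[xd ?]|[? ->]]; split => //; last by rewrite lexx.
  by apply/eqP; rewrite eq_le andbC.
Qed.

Lemma mm_D0_R0 a x : mm_class a = Graph -> D a x -> D0 a x <-> R0 a (mm_f a x).
Proof.
move=> ca ax; rewrite /mm_D0 /mm_R0 ca /=.
case: (mm_f_homeo ca) => bij_f cf _.
by rewrite (segment_bij_interior (mm_dl_dr ca) bij_f cf).
Qed.

Lemma mm_G0P a x y : G0 a (x, y) <-> R0 a y /\ x = h a y.
Proof.
case ca: (mm_class a); last 2 first.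
- rewrite /mm_G0 /h /inverse_branch /mm_D0 ca /=.
  by split=> -[? ?].
- rewrite /mm_G0 /h /inverse_branch /mm_D0 ca /=.
  by split=> -[? ?].
have gE := mm_GP a x y; rewrite /mm_G /mm_G0 ca /= in gE *; split.
  move=> [ax E]; have aDx := mm_D0_sub ax; split.
    by rewrite E; apply/mm_D0_R0.
  by apply gE; split.
move=> [ay E]; have [aDx E'] : D a x /\ y = mm_f a x.
  by apply gE; split => //; exact: mm_R0_sub.
by split => //; apply/mm_D0_R0; rewrite -?E'.
Qed.

Lemma mm_G0_G a xy : G0 a xy -> G a xy.
Proof.
by case: xy => x y /mm_G0P[ay E]; apply/mm_GP; split => //; exact: mm_R0_sub.
Qed.

Lemma mm_G_D a x y : G a (x, y) -> D a x.
Proof. by rewrite /mm_G; case: (mm_class a) => -[]. Qed.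

Lemma mm_G0_D0 a x y : G0 a (x, y) -> D0 a x.
Proof. by rewrite /mm_G0; case: (mm_class a) => -[]. Qed.

Lemma mm_D0_G0 a x : D0 a x -> exists y, G0 a (x, y).
Proof.
move=> ax; case ca: (mm_class a).
- by exists (mm_f a x); rewrite /mm_G0 ca.
- by have [y ay] := mm_R0_neq0 a; exists y; rewrite /mm_G0 ca.
- by have [y ay] := mm_R0_neq0 a; exists y; rewrite /mm_G0 ca.
Qed.

(** A boundary point is an end of the arc: in a graph cell both coordinates are then endpoints, in a
    vertical cell [x] is always in P, and a point cell has no boundary. *)
Lemma mm_G_boundary a x y : G a (x, y) -> ~ R0 a y ->
  range p x /\ range p y.
Proof.
move=> axy nay; have := axy; have [aRy _] := (mm_GP a x y).1 axy.
rewrite /mm_G; case ca: (mm_class a) => /= -[aDx].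
- move=> yE; rewrite yE -mm_D0_R0 // in nay; move: nay (aDx) (aRy).
  have := mm_D0_R0 ca aDx; rewrite -yE.
  rewrite /mm_R0 /mm_D0 ca /mm_D /mm_R /= !in_itv /= => E1 E2 E3 E4; split.
    have [->|/eqP n1] := eqVneq x (p (mm_dl a)); first by exists (mm_dl a).
    have [->|/eqP n2] := eqVneq x (p (mm_dr a)); first by exists (mm_dr a).
    by exfalso; apply: E2; lra.
  have [->|/eqP n1] := eqVneq y (p (mm_rl a)); first by exists (mm_rl a).
  have [->|/eqP n2] := eqVneq y (p (mm_rr a)); first by exists (mm_rr a).
  by exfalso; apply/E2/E1; lra.
- move: aDx; rewrite /mm_D; have := mm_D_spec a; rewrite ca => -> /= + _.
  rewrite in_itv /= -eq_le => /eqP <-; split; first by exists (mm_dl a).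
  move: nay aRy; rewrite /mm_R0 ca /mm_R /= !in_itv /= => E2 E4.
  have [->|/eqP n1] := eqVneq y (p (mm_rl a)); first by exists (mm_rl a).
  have [->|/eqP n2] := eqVneq y (p (mm_rr a)); first by exists (mm_rr a).
  by exfalso; apply: E2; lra.
- exfalso; apply: nay; move: aRy; rewrite /mm_R0 ca /mm_R /=.
  by have := mm_R_spec a; rewrite ca => ->; rewrite in_itv /= -eq_le eq_sym => /eqP.
Qed.

(** Open graph cells avoid P in the first coordinate and open vertical cells avoid it in the
    second. *)
Lemma mm_G0_point a x y : G0 a (x, y) -> range p x -> range p y ->
  mm_class a = Point.
Proof.
move=> axy [i _ ix] [j _ jy]; case ca: (mm_class a) => //; exfalso.
- by apply: (@mm_D0_graphN a i ca); rewrite ix; exact: mm_G0_D0 axy.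
- by apply: (@mm_R0_verticalN a j ca); rewrite jy; have /mm_G0P[] := axy.
Qed.

Lemma mm_DP a x : D a x -> ~ range p x -> mm_class a = Graph /\ D0 a x.
Proof.
rewrite /mm_D /mm_D0 => ax nx.
have n1 : x <> p (mm_dl a) by move=> E; apply: nx; exists (mm_dl a).
have n2 : x <> p (mm_dr a) by move=> E; apply: nx; exists (mm_dr a).
have := mm_D_spec a; move: ax; rewrite /= in_itv /=.
case: (mm_class a) => /=; first by move=> ? _; split => //; rewrite in_itv /=; lra.
- by move=> + E; move: n2; rewrite E; lra.
- by move=> + E; move: n2; rewrite E; lra.
Qed.

Lemma clamp_branch_D a y : R' a y -> D a (h a y).
Proof. by move=> ay; apply: (@mm_G_D _ _ y); apply/mm_GP. Qed.

Lemma clamp_branch_D0 a y : R0 a y -> D0 a (h a y).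
Proof. by move=> ay; apply: (@mm_G0_D0 _ _ y); apply/mm_G0P. Qed.

Lemma clamp_branch_continuous a : continuous (h a).
Proof.
case ca: (mm_class a); last 2 first.
- have -> : h a = cst (p (mm_dl a)) by apply/funext => y; rewrite /h /inverse_branch ca.
  exact: cst_continuous.
- have -> : h a = cst (p (mm_dl a)) by apply/funext => y; rewrite /h /inverse_branch ca.
  exact: cst_continuous.
have [_ _ /subspace_continuousP cg] := mm_f_homeo ca.
pose c y : R := Num.max (p (mm_rl a)) (Num.min (p (mm_rr a)) y).
have cR y : R' a (c y).
  rewrite /mm_R /= in_itv /= /c; have := mm_rl_rr a.
  by rewrite maxEle minEle; case: ifP; case: ifP; lra.
have cc : continuous c.
  move=> y; apply: continuous_max; first exact: cst_continuous.
  by apply: continuous_min; [exact: cst_continuous|exact: cvg_id].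
move=> y; have -> : h a = inverse_on (mm_D a) (mm_f a) \o c.
  by apply/funext => z; rewrite /h /inverse_branch ca.
apply: (@cvg_comp _ _ _ c _ _ (within (R' a) (nbhs (c y)))).
  move=> S; rewrite /within /= => nS.
  have nS' : nbhs y [set z | R' a (c z) -> S (c z)] := cc y _ nS.
  by apply: (@filterS _ (nbhs y) _ _ _ _ nS') => z /=; apply; exact: cR.
exact: (cg (c y) (cR y)).
Qed.

End Geometry.

(** * Trajectories and their codes *)

(** Words of a subshift are read in infinite sequences, so finite paths have to be prolonged; from
    the last vertex on, a chosen successor inside [C] is iterated. *)
Lemma path_extend (T : Type) (e : rel T) (C : set T) (a : T) (s : seq T) :
  (forall c, C c -> exists2 d, C d & e c d) ->
  (forall k, (k <= size s)%N -> C (nth a (a :: s) k)) -> path e a s ->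
  exists z : nat -> T, [/\ forall k, e (z k) (z k.+1), forall k, C (z k) &
    forall k, (k <= size s)%N -> z k = nth a (a :: s) k].
Proof.
move=> next Cs path_s.
have /choice[succ succP] : forall c, exists d, C c -> C d /\ e c d.
  by move=> c; have [/next[d Cd cd]|nC] := pselect (C c); [exists d|exists c].
pose l := last a s; have Cl : C l by rewrite /l (last_nth a); exact: Cs.
pose z k := if (k <= size s)%N then nth a (a :: s) k else iter (k - size s) succ l.
have iterC m : C (iter m succ l) by elim: m => //= m /succP[].
exists z; split=> k; rewrite /z.
- have [ks|sk] := ltnP k (size s).
    rewrite (ltnW ks); exact: (pathP _ path_s).
  have [ks|ks] := leqP k (size s); last by rewrite subSn 1?ltnW //; exact: (succP _ _).2.
  have -> : k = size s by apply/eqP; rewrite eqn_leq ks.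
  by rewrite subSnn -last_nth; exact: (succP _ Cl).2.
- by case: ifP => [/Cs|].
- by move=> ->.
Qed.

Section Trajectories.
Variables (R : realType) (F : markov_multimap R).
Local Notation A := (mm_symbol F).
Local Notation p := (@mm_p R F).
Local Notation D := (@mm_D R F).
Local Notation D0 := (@mm_D0 R F).
Local Notation R' := (@mm_R R F).
Local Notation R0 := (@mm_R0 R F).
Local Notation G := (@mm_G R F).
Local Notation G0 := (@mm_G0 R F).
Local Notation h := (@clamp_branch R F).
Implicit Types (a b : A) (z u v : nat -> A) (x : nat -> R) (t : R).

Definition mm_next a b : bool := `[< D0 b `<=` R0 a >].

Lemma sftP z : @sft R F z <-> forall k, mm_next (z k) (z k.+1).
Proof.
split=> Hz k; have := Hz k; rewrite /transition /mm_next; case: asboolP => //.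
Qed.

Lemma mm_next_R0 a b t : mm_next a b -> D0 b t -> R0 a t.
Proof. by move=> /asboolP; apply. Qed.

Lemma mm_next_R a b t : mm_next a b -> D b t -> R' a t.
Proof.
move=> ab; have [s bs] := mm_D0_neq0 b.
have [_] := mm_meet (mm_next_R0 ab bs) bs; exact.
Qed.

Lemma mm_nextI a b t : R0 a t -> D0 b t -> mm_next a b.
Proof. by move=> ta tb; apply/asboolP; have [] := mm_meet ta tb. Qed.

Fixpoint pullback z n t : R :=
  if n is n'.+1 then h (z 0%N) (pullback (fun i => z i.+1) n' t) else t.

(* The k-th coordinate, for k <= n, of the orbit segment with code z that is at
   t at time n. *)
Definition orbit_segment z n t k := pullback (fun i => z (k + i)%N) (n - k) t.

Lemma orbit_segment_last z n t : orbit_segment z n t n = t.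
Proof. by rewrite /orbit_segment subnn. Qed.

Lemma orbit_segment_rec z n t k : (k < n)%N ->
  orbit_segment z n t k = h (z k) (orbit_segment z n t k.+1).
Proof.
move=> kn; rewrite /orbit_segment -(subnSK kn) /= addn0.
by congr (h _ (pullback _ _ _)); apply/funext => i; rewrite addnS.
Qed.

Lemma orbit_segment_continuous z n k :
  continuous (fun t => orbit_segment z n t k).
Proof.
rewrite /orbit_segment; move: (n - k)%N (fun i => z (k + i)%N) => {n k}m.
elim: m => [|m IH] w t /=; first exact: cvg_id.
apply: (@continuous_comp _ _ _ (fun t => pullback (fun i => w i.+1) m t) (h (w 0%N))).
  exact: IH.
exact: clamp_branch_continuous.
Qed.

Lemma downward_ind (P : nat -> Prop) n : P n ->
  (forall k, (k < n)%N -> P k.+1 -> P k) -> forall k, (k <= n)%N -> P k.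
Proof.
move=> Pn IH k kn; rewrite -(subKn kn); elim: (n - k)%N => [|m Pm].
  by rewrite subn0.
have [nm|mn] := leqP n m.
  by move: Pm; have -> : (n - m = n - m.+1)%N by lia.
by apply: IH; [lia|rewrite subnSK].
Qed.

Definition coded (H : A -> set (R * R)) z n x :=
  forall k, (k < n)%N -> H (z k) (x k, x k.+1).

(** Each coordinate is the inverse branch of the next one, so the code and the last coordinate
    determine the whole segment. *)
Lemma coded_orbit_segment z n x : coded G z n x ->
  forall k, (k <= n)%N -> x k = orbit_segment z n (x n) k.
Proof.
move=> zx; apply: downward_ind; first by rewrite orbit_segment_last.
move=> k kn IH; rewrite orbit_segment_rec // -IH.
by have /mm_GP[] := zx k kn.
Qed.

Section Admissible.
Variables (z : nat -> A) (z_next : forall k, mm_next (z k) (z k.+1)).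

Lemma orbit_segment_D n t k : (k <= n)%N ->
  D (z n) t -> D (z k) (orbit_segment z n t k).
Proof.
move=> + nt; move: k; apply: downward_ind; first by rewrite orbit_segment_last.
move=> k kn IH; rewrite orbit_segment_rec //; apply: clamp_branch_D.
exact: mm_next_R (z_next k) IH.
Qed.

Lemma orbit_segment_D0 n t k : (k <= n)%N ->
  D0 (z n) t -> D0 (z k) (orbit_segment z n t k).
Proof.
move=> + nt; move: k; apply: downward_ind; first by rewrite orbit_segment_last.
move=> k kn IH; rewrite orbit_segment_rec //; apply: clamp_branch_D0.
exact: mm_next_R0 (z_next k) IH.
Qed.

(** The hypothesis concerns [z n], one symbol beyond the [n] coded steps; admissibility puts its
    domain inside the range of the symbol before it. *)
Lemma orbit_segment_coded n t : D (z n) t -> coded G z n (orbit_segment z n t).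
Proof.
move=> nt k kn; apply/mm_GP; rewrite -orbit_segment_rec //; split => //.
apply: mm_next_R (z_next k) _; exact: orbit_segment_D.
Qed.

Lemma orbit_segment_coded0 n t :
  D0 (z n) t -> coded G0 z n (orbit_segment z n t).
Proof.
move=> nt k kn; apply/mm_G0P; rewrite -orbit_segment_rec //; split => //.
apply: mm_next_R0 (z_next k) _; exact: orbit_segment_D0.
Qed.

End Admissible.

(* If the closed cell of v meets the open cell of u in x, then a boundary
   coordinate of x at time k is a boundary coordinate at every later time, and
   lies in P; a last symbol of u other than a point excludes this. *)
Lemma coded_interior u v n x :
  (forall k, mm_next (v k) (v k.+1)) -> mm_class (u n) <> Point ->
  coded G0 u n.+1 x -> coded G v n.+1 x -> coded G0 v n.+1 x.
Proof.
move=> vnext un ux vx k kn; apply: contrapT => nk.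
have bad m : (k <= m)%N -> (m <= n)%N -> ~ G0 (v m) (x m, x m.+1).
  elim: m => [|m IH] km mn; first by move: km nk; rewrite leqn0 => /eqP ->.
  have [kE|km'] := eqVneq k m.+1; first by rewrite -kE.
  (* If step [m.+1] were in its open cell, [x m.+1] would lie in [D0 (v m.+1)], hence in [R0 (v m)],
     and step [m] would be in its open cell too. *)
  have {}IH := IH ltac:(lia) ltac:(lia) => /mm_G0_D0 Dm.
  apply: IH; apply/mm_G0P; split; first exact: mm_next_R0 (vnext m) Dm.
  by have /mm_GP[] := vx m ltac:(lia).
have := bad n kn (leqnn n) => nbad.
have nR : ~ R0 (v n) (x n.+1).
  by move=> nR; apply: nbad; apply/mm_G0P; split => //; have /mm_GP[] := vx n (ltnSn n).
have [px py] := mm_G_boundary (vx n (ltnSn n)) nR.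
exact: un (mm_G0_point (ux n (ltnSn n)) px py).
Qed.

Lemma mm_graph_next t : 0 <= t <= 1 -> exists s, mm_graph F (t, s).
Proof.
move=> t01; have : (`[0, 1]%classic : set R) t by rewrite /= in_itv.
rewrite (mm_cover F) => -[a _ aDt]; case ca: (mm_class a).
- by exists (mm_f a t), a => //; rewrite /mm_G ca.
- exists (p (mm_rl a)), a => //; rewrite /mm_G ca; split=> //=.
  by rewrite /mm_R /= in_itv /= lexx mm_rl_rr.
- exists (p (mm_rl a)), a => //; rewrite /mm_G ca; split=> //=.
  by rewrite /mm_R /= in_itv /= lexx mm_rl_rr.
Qed.

Lemma mm_graph01 t s : mm_graph F (t, s) -> 0 <= t <= 1 /\ 0 <= s <= 1.
Proof.
move=> [a _ ats]; split; first exact: mm_D_sub01 (mm_G_D ats).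
by have /mm_GP[/mm_R_sub01] := ats.
Qed.

Lemma trajectoriesP x :
  trajectories F x <-> forall k, mm_graph F (x k, x k.+1).
Proof.
split=> [[_ H] k|H]; first exact: H.
by split=> k; [rewrite /= in_itv /=; have [] := mm_graph01 (H k)|exact: H].
Qed.

Lemma trajectory_extend n x : 0 <= x n <= 1 ->
  (forall k, (k < n)%N -> mm_graph F (x k, x k.+1)) ->
  exists y : trajectory_space F, forall k, (k <= n)%N -> set_val y k = x k.
Proof.
move=> xn xG.
have /choice[next nextP] : forall t, exists s, 0 <= t <= 1 -> mm_graph F (t, s).
  move=> t; have [/mm_graph_next[s]|] := boolP (0 <= t <= 1); first by exists s.
  by exists t.
have iter01 m : 0 <= iter m next (x n) <= 1.
  by elim: m => //= m /nextP/mm_graph01[].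
pose y k := if (k <= n)%N then x k else iter (k - n) next (x n).
have yT : trajectories F y.
  apply/trajectoriesP => k; rewrite /y; have [kn|nk] := ltnP k n.
    by rewrite (ltnW kn); exact: xG.
  have [kn|kn] := leqP k n; last by rewrite subSn 1?ltnW //; exact: nextP.
  have -> : k = n by lia.
  by rewrite subSnn; exact: nextP.
by exists (exist _ y (mem_set yT)) => k kn; rewrite set_valE /= /y kn.
Qed.

(** * Admissible codes of trajectories under proper parametrization *)

Hypothesis hF : properly_parametrized F.

Lemma mm_graph_G0 t s : mm_graph F (t, s) -> exists a, G0 a (t, s).
Proof. by case: hF => <- _ _ [_ [a _ <-] ats]; exists a. Qed.

(** Only the cells are shown to agree, as the partition is one of the set of cells and distinct
    symbols may share a cell. *)
Lemma mm_G0_inj a b t s : G0 a (t, s) -> G0 b (t, s) -> G0 a = G0 b.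
Proof.
move=> at_ bt; case: hF => _ /trivIsetP tI _.
apply: contrapT => /eqP ab; have := tI _ _ (imageT _ a) (imageT _ b) ab.
by rewrite -subset0 => /(_ (t, s)); apply.
Qed.

Lemma mm_next_exists a : exists b, mm_next a b.
Proof.
have [t at_] := mm_R0_neq0 a; have t01 := mm_R_sub01 (mm_R0_sub at_).
have [s /mm_graph_G0[b /mm_G0_D0 bt]] := mm_graph_next t01.
by exists b; exact: mm_nextI at_ bt.
Qed.

(** Admissibility depends only on the cells, so symbols with a common cell can be exchanged in a
    path. *)
Lemma mm_next_G0l a a' b : G0 a = G0 a' -> mm_next a b -> mm_next a' b.
Proof.
move=> E ab; have [t bt] := mm_D0_neq0 b.
have : G0 a (h a t, t) by apply/mm_G0P; split=> //; exact: mm_next_R0 ab bt.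
by rewrite E => /mm_G0P[at_ _]; exact: mm_nextI at_ bt.
Qed.

Lemma mm_next_G0r a b b' : G0 b = G0 b' -> mm_next a b -> mm_next a b'.
Proof.
move=> E ab; have [t bt] := mm_D0_neq0 b; have [s bts] := mm_D0_G0 bt.
by rewrite E in bts; exact: mm_nextI (mm_next_R0 ab bt) (mm_G0_D0 bts).
Qed.

Lemma trajectory_code x : trajectories F x ->
  exists2 z, (forall k, mm_next (z k) (z k.+1)) &
    forall k, G0 (z k) (x k, x k.+1).
Proof.
move=> /trajectoriesP xG.
have /choice[z zP] k : exists a, G0 a (x k, x k.+1) by exact: mm_graph_G0.
exists z => // k; have /mm_G0P[zk _] := zP k.
exact: mm_nextI zk (mm_G0_D0 (zP k.+1)).
Qed.

Lemma finite_trajectory_code n x : (forall k, (k <= n)%N -> 0 <= x k <= 1) ->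
  (forall k, (k < n)%N -> mm_graph F (x k, x k.+1)) ->
  exists2 z, (forall k, mm_next (z k) (z k.+1)) & coded G0 z n x.
Proof.
move=> x01 xG; have [y yx] := trajectory_extend (x01 n (leqnn n)) xG.
have [z zn zy] := trajectory_code (set_mem (valP y)).
by exists z => // k kn; rewrite -(yx k (ltnW kn)) -(yx _ kn); exact: zy.
Qed.

Lemma words_sft_path n (u : n.+1.-tuple A) :
  words (@sft R F) u <-> path mm_next (thead u) (behead u).
Proof.
split=> [[z /sftP zs [k uz]]|up].
  have -> : behead u = [seq z (k + i.+1)%N | i <- iota 0 n].
    apply: (@eq_from_nth _ (thead u)).
      by rewrite size_map size_iota size_behead size_tuple.
    move=> i; rewrite size_behead size_tuple /= => i_n.
    rewrite (nth_map 0%N) ?size_iota // nth_iota //= add0n.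
    rewrite nth_behead -(uz (Ordinal (i_n : i.+1 < n.+1)%N)).
    by rewrite (tnth_nth (thead u)).
  apply/(pathP (thead u)) => i; rewrite size_map size_iota => i_n.
  rewrite (nth_map 0%N) ?size_iota // nth_iota //= add0n addnS.
  case: i i_n => [|i] i_n /=; first by rewrite /thead uz /= addn0; exact: zs.
  by rewrite (nth_map 0%N) ?size_iota 1?ltnW // nth_iota 1?ltnW //= add0n; exact: zs.
have [z [z1 _ z3]] : exists z : nat -> A, [/\ forall k, mm_next (z k) (z k.+1),
    forall k, [set: A] (z k) & forall k, (k <= size (behead u))%N ->
      z k = nth (thead u) (thead u :: behead u) k].
  by apply: path_extend => // c _; have [d] := mm_next_exists c; exists d.
exists z; first by apply/sftP.
exists 0%N => i; rewrite add0n z3; last by rewrite size_behead size_tuple -ltnS.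
by rewrite (tnth_nth (thead u)); case: u {up z3} i => -[|a s] //= us i; rewrite -theadE.
Qed.

End Trajectories.

(** * Topology of the cells *)

Lemma ptws_cvg (I : Type) (K : topologicalType) (H : set_system (I -> K))
    (f : I -> K) : Filter H -> (forall i, (fun g => g i) @ H --> f i) ->
  H --> (f : {ptws I -> K}).
Proof.
move=> FH Hf; apply/cvg_sup => i W.
rewrite nbhsE => -[B [[V oV <-] Vf] VW]; apply: filterS VW _.
exact: Hf i V (open_nbhs_nbhs (conj oV Vf)).
Qed.

Lemma ptws_continuous (S : topologicalType) (I : Type) (K : topologicalType)
    (f : S -> {ptws I -> K}) :
  (forall i, continuous (fun s => f s i)) -> continuous f.
Proof. by move=> fc s; apply: (@ptws_cvg I K) => i; exact: fc. Qed.

Lemma ptws_open_ball (R : realType) (U : set {ptws nat -> R}) (x : nat -> R) :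
  open U -> U x -> exists n : nat, exists2 e : R, 0 < e &
    forall y : nat -> R, (forall k, (k <= n)%N -> `|y k - x k| < e) -> U y.
Proof.
move=> oU Ux.
(* One index bounds both the number of controlled coordinates and the radius, so the sets [B n]
   decrease and generate a filter, which converges to [x]. *)
pose B (n : nat) := [set y : nat -> R |
  forall k, (k <= n)%N -> `|y k - x k| < n.+1%:R^-1].
have FB : Filter (filter_from [set: nat] B).
  apply: filter_from_filter; first by exists 0%N.
  move=> i j _ _; exists (maxn i j) => // y By; split=> k ki.
    apply: lt_le_trans (By k _) _; first by rewrite leq_max ki.
    by rewrite lef_pV2 ?posrE ?ltr0Sn// ler_nat ltnS leq_maxl.
  apply: lt_le_trans (By k _) _; first by rewrite leq_max ki orbT.
  by rewrite lef_pV2 ?posrE ?ltr0Sn// ler_nat ltnS leq_maxr.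
have Bx : filter_from [set: nat] B --> (x : {ptws nat -> R}).
  apply: ptws_cvg => k; apply/cvgrPdist_lt => e e0.
  have [m me] := ltr_add_invr e0; exists (maxn k m) => // y By.
  rewrite /= distrC; apply: lt_trans (By k (leq_maxl _ _)) _.
  rewrite add0r in me; apply: le_lt_trans me.
  by rewrite lef_pV2 ?posrE ?ltr0Sn// ler_nat ltnS leq_maxr.
have [n _ BU] := Bx U (open_nbhs_nbhs (conj oU Ux)).
by exists n, n.+1%:R^-1 => //; rewrite invr_gt0 ltr0Sn.
Qed.

Section Cells.
Variables (R : realType) (F : markov_multimap R).
Local Notation A := (mm_symbol F).
Local Notation G := (@mm_G R F).
Local Notation G0 := (@mm_G0 R F).
Variable n : nat.
Local Notation X := (finite_trajectory_space F n.+1).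
Implicit Types (u v : n.-tuple A) (w : X) (z : nat -> A).

(** Indexing by [nat] makes [coded] applicable; beyond [n], [inord k] is the first index, so those
    values carry no information. *)
Definition nat_point w : nat -> R := fun k => set_val w (inord k).

Lemma nat_pointS w (H : A -> set (R * R)) v (k : 'I_n) :
  H (tnth v k) (set_val w (widen_ord (leqnSn n) k), set_val w (lift ord0 k)) =
  H (tnth v k) (nat_point w k, nat_point w k.+1).
Proof.
rewrite /nat_point; congr (H _ (set_val w _, set_val w _)); apply/val_inj => /=.
  by rewrite inordK // ltnS ltnW.
by rewrite inordK // ltnS.
Qed.

Definition cell (H : A -> set (R * R)) v : set X := [set w | forall k : 'I_n,
  H (tnth v k) (set_val w (widen_ord (leqnSn n) k), set_val w (lift ord0 k))].

Lemma cell_coded H z w :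
  cell H [tuple z i | i < n] w <-> coded H z n (nat_point w).
Proof.
split=> [Hw k kn|Hw k]; last by rewrite nat_pointS tnth_mktuple; exact: Hw.
by have := Hw (Ordinal kn); rewrite nat_pointS tnth_mktuple.
Qed.

Lemma nat_point_continuous k : continuous (fun w => nat_point w k).
Proof.
move=> w; apply: (@continuous_comp _ _ _ (fun w : X => set_val w)
  (fun g : {ptws 'I_n.+1 -> R} => g (inord k))).
  exact: initial_continuous.
exact: (@proj_continuous _ (fun _ : 'I_n.+1 => R)).
Qed.

(** Each step imposes two closed conditions: membership in [mm_R a], and an equation between
    continuous functions, the clamped branch being continuous on the whole line. *)
Lemma closed_cell v : closed (cell G v).
Proof.
have -> : cell G v = \bigcap_(k in [set: 'I_n])
    [set w | G (tnth v k) (nat_point w k, nat_point w k.+1)].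
  apply/seteqP; split=> w Hw k; first by move=> _ /=; rewrite -nat_pointS; exact: Hw.
  by rewrite nat_pointS; exact: Hw.
apply: closed_bigI => k _; set a := tnth v k.
have -> : [set w | G a (nat_point w k, nat_point w k.+1)] =
    (fun w => nat_point w k.+1) @^-1` mm_R a `&`
    (fun w => nat_point w k - clamp_branch a (nat_point w k.+1)) @^-1` [set x | x = 0].
  apply/seteqP; split=> w /=; first by move/mm_GP => [? ->]; rewrite subrr.
  by move=> [? /eqP]; rewrite subr_eq0 => /eqP E; apply/mm_GP.
apply: closedI; apply: preimage_closed => [w _|].
- exact: nat_point_continuous.
- exact: interval_closed.
- apply: cvgB; [exact: (@nbhs_filter X w)|exact: nat_point_continuous|].
  apply: (@continuous_comp _ _ _ (fun w => nat_point w k.+1) (clamp_branch a)).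
    exact: nat_point_continuous.
  exact: clamp_branch_continuous.
- exact: closed_eq.
Qed.

(** There are finitely many words of length [n], so the closed cells disjoint from [S] have a closed
    union, and [S] is what this union leaves of [W]. *)
Lemma open_by_cells (S W : set X) : open W -> S `<=` W ->
  (forall w, W w -> ~ S w -> exists2 v, cell G v w & cell G v `&` S = set0) ->
  open S.
Proof.
move=> oW SW cov.
have -> : S = W `&` ~` \bigcup_(v in [set v | cell G v `&` S = set0]) cell G v.
  apply/seteqP; split=> [w Sw|w [Ww nw]].
    split; first exact: SW.
    by move=> [v /= vS vw]; have : (cell G v `&` S) w by []; rewrite vS.
  apply: contrapT => /(cov _ Ww)[v vw vS]; apply: nw; exists v => //.
apply: openI => //; apply: closed_openC; apply: closed_bigcup.
  exact: finite_finset.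
by move=> v _; exact: closed_cell.
Qed.

Lemma finite_trajectoryP (x : 'I_n.+1 -> R) : finite_trajectories F x <->
  (forall i, 0 <= x i <= 1) /\
  (forall i j : 'I_n.+1, j = i.+1 :> nat -> mm_graph F (x i, x j)).
Proof.
by split=> -[H1 H2]; split=> // i; have := H1 i; rewrite /= in_itv.
Qed.

Lemma nat_point_graph w : (forall k, 0 <= nat_point w k <= 1) /\
  (forall k, (k < n)%N -> mm_graph F (nat_point w k, nat_point w k.+1)).
Proof.
have /finite_trajectoryP[w1 w2] := set_mem (valP w).
split=> [k|k kn]; first exact: w1.
by apply: w2; rewrite !inordK // ltnS // ltnW.
Qed.

Lemma trajectory_restrict (x : trajectory_space F) :
  exists w : X, forall k, (k <= n)%N -> nat_point w k = set_val x k.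
Proof.
have [x1 x2] := set_mem (valP x).
have xF : finite_trajectories F (fun i : 'I_n.+1 => set_val x i).
  split=> [i|i j ij]; first exact: x1.
  by rewrite ij; exact: x2.
exists (exist (fun y => y \in @finite_trajectories R F n.+1) _ (mem_set xF)) => k kn.
by rewrite /nat_point set_valE /= inordK.
Qed.

Lemma nat_point_inj w w' : (forall k, (k <= n)%N -> nat_point w k = nat_point w' k) ->
  w = w'.
Proof.
move=> E; apply/val_inj/funext => i.
by have := E i; rewrite /nat_point -ltnS ltn_ord inord_val; exact.
Qed.

(** The set of infinite trajectories is the preimage of the finite cell under the continuous
    restriction to the first coordinates. *)
Lemma open_trajectory_cell u : open (cell G0 u) ->
  open [set x : trajectory_space F |
    forall k : 'I_n, G0 (tnth u k) (set_val x k, set_val x k.+1)].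
Proof.
move=> [V oV VE].
pose r (x : trajectory_space F) : {ptws 'I_n.+1 -> R} := fun i => set_val x i.
have rc : continuous r.
  apply: ptws_continuous => i x; apply: (@continuous_comp _ _ _
    (fun x : trajectory_space F => set_val x) (fun g : {ptws nat -> R} => g i)).
    exact: initial_continuous.
  exact: (@proj_continuous _ (fun _ : nat => R)).
suff -> : [set x : trajectory_space F |
    forall k : 'I_n, G0 (tnth u k) (set_val x k, set_val x k.+1)] = r @^-1` V.
  by apply: open_comp => // y _; exact: rc.
have rP (x : trajectory_space F) : V (r x) <->
    forall k : 'I_n, G0 (tnth u k) (set_val x k, set_val x k.+1).
  have [w wx] := trajectory_restrict x.
  have rw : set_val w = r x.
    by apply/funext => i; rewrite /r -wx -1?ltnS ?ltn_ord // /nat_point inord_val.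
  have wk (k : 'I_n) : (nat_point w k, nat_point w k.+1) = (set_val x k, set_val x k.+1).
    by rewrite !wx // ltnW.
  have -> : V (r x) = cell G0 u w by rewrite -VE -rw.
  by split=> H k; have := H k; rewrite nat_pointS wk.
by apply/seteqP; split=> x /rP.
Qed.

End Cells.

(** * Essential words *)

(** Serves to pick a point outside P; the interval is cut at each point of [s] that falls inside
    it. *)
Lemma avoid_seq (R : realType) (s : seq R) (a b : R) : a < b ->
  exists2 t, a < t < b & t \notin s.
Proof.
move=> ab; suff [c [d [ac cd db sN]]] : exists c d : R,
    [/\ a <= c, c < d, d <= b & forall t, t \in s -> ~~ (c < t < d)].
  exists ((c + d) / 2); first lra.
  by apply/negP => /sN /negP; apply; lra.
elim: s => [|q s [c [d [ac cd db sN]]]]; first by exists a, b.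
have [cqd|ncqd] := boolP (c < q < d).
  exists c, q; split=> //; try lra.
  move=> t; rewrite inE => /predU1P[->|/sN]; first by rewrite ltxx andbF.
  by apply: contra; lra.
exists c, d; split=> // t; rewrite inE => /predU1P[->//|/sN//].
Qed.

Lemma dist_lt_open (R : realType) (c e : R) : open [set y : R | `|y - c| < e].
Proof.
have [e0|e0] := ltP 0 e; last first.
  rewrite (_ : [set y | _] = set0) ?predeqE; first exact: open0.
  by move=> y /=; split => // /lt_le_trans/(_ e0); rewrite normr_lt0.
rewrite (_ : [set y | _] = ball c e); first exact: ball_open.
by apply/seteqP; split=> y; rewrite /ball /= distrC.
Qed.

Lemma interval_length_ge (R : realType) (I : set R) (s t : R) :
  I `<=` `[0, 1]%classic -> I s -> I t -> `|s - t| <= interval_length I.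
Proof.
move=> I01 Is It.
have ubI : has_ubound I by exists 1 => x /I01 /=; rewrite in_itv /= => /andP[].
have lbI : has_lbound I by exists 0 => x /I01 /=; rewrite in_itv /= => /andP[].
have := ub_le_sup ubI Is; have := ub_le_sup ubI It.
have := ge_inf lbI Is; have := ge_inf lbI It.
rewrite /interval_length ler_norml; lra.
Qed.

Lemma mktuple_mkseq (T : Type) (z : nat -> T) n :
  tval [tuple z i | i < n] = mkseq z n.
Proof. by rewrite /= /mkseq -val_enum_ord -map_comp enumT. Qed.

Lemma mkseq_cons (T : Type) (z : nat -> T) n :
  mkseq z n.+1 = z 0%N :: mkseq (fun i => z i.+1) n.
Proof. by rewrite /mkseq /= (iotaDl 1 0) -map_comp. Qed.

Section Essential.
Variables (R : realType) (F : markov_multimap R).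
Hypothesis hF : properly_parametrized F.
Local Notation A := (mm_symbol F).
Local Notation p := (@mm_p R F).
Local Notation D := (@mm_D R F).
Local Notation R' := (@mm_R R F).
Local Notation R0 := (@mm_R0 R F).
Local Notation G := (@mm_G R F).
Local Notation G0 := (@mm_G0 R F).
Implicit Types (a b : A) (z u v : nat -> A) (x : nat -> R) (t : R).

Lemma words_code n z : (forall k, mm_next (z k) (z k.+1)) ->
  words (@sft R F) [tuple z i | i < n].
Proof.
move=> zn; exists z; first exact/sftP.
by exists 0%N => i; rewrite tnth_mktuple.
Qed.

(** A segment [w] outside the open cell has its own code [v]. The closed cell of [v] misses the open
    cell of [z]: at a common point [coded_interior] would make the open cells equal, and [w] would
    be coded by [z]. *)
Lemma essential_word_code n z :
  (forall k, mm_next (z k) (z k.+1)) -> mm_class (z n) <> Point ->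
  essential_word [tuple z i | i < n.+1].
Proof.
move=> zn zP; split; first exact: words_code.
apply: (@open_by_cells R F n.+1 _ setT) => [|//|w _ wz]; first exact: openT.
have [w01 wG] := nat_point_graph w.
have [v vn vw] := finite_trajectory_code hF (fun k _ => w01 k) wG.
exists [tuple v i | i < n.+1].
  by apply/cell_coded => k kn; apply: mm_G0_G; exact: vw.
rewrite -subset0 => w' [/cell_coded vw' /cell_coded zw'].
have vw0 := coded_interior vn zP zw' vw'.
apply/wz/cell_coded => k kn.
by rewrite (mm_G0_inj hF (zw' k kn) (vw0 k kn)); exact: vw.
Qed.

Lemma essential_symbols_code n z k : (k <= n)%N ->
  (forall k, mm_next (z k) (z k.+1)) -> mm_class (z n) <> Point ->
  @essential_symbols R F (z k).
Proof.
move=> kn zn zP; exists n.+1, [tuple z i | i < n.+1].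
  exact: essential_word_code.
rewrite memtE mktuple_mkseq; apply/mapP; exists k => //.
by rewrite mem_iota add0n.
Qed.

Lemma mm_G_point a s t : mm_class a = Point -> G a (s, t) -> t = p (mm_rl a).
Proof.
move=> aP /mm_GP[]; have := mm_R_spec a; rewrite aP /mm_R => <- /= + _.
by rewrite in_itv /= -eq_le eq_sym => /eqP.
Qed.

Lemma coded_eq n z x x' : x n = x' n -> coded G z n x -> coded G z n x' ->
  forall k, (k <= n)%N -> x k = x' k.
Proof.
move=> xn zx zx' k kn.
by rewrite (coded_orbit_segment zx kn) (coded_orbit_segment zx' kn) xn.
Qed.

Lemma coded_G n z x : coded G0 z n x -> coded G z n x.
Proof. by move=> zx k kn; exact: mm_G0_G (zx k kn). Qed.

(* A cell whose code ends with a point symbol is a single point, so the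
   hypothesis on W makes W finite, hence w isolated. *)
Lemma essential_word_isolated n z
    (W : set (finite_trajectory_space F n.+2)) w :
  (forall k, mm_next (z k) (z k.+1)) -> open W -> W w ->
  coded G0 z n.+1 (nat_point w) ->
  (forall w' v, W w' -> coded G0 v n.+1 (nat_point w') ->
    (forall k, mm_next (v k) (v k.+1)) -> mm_class (v n) = Point) ->
  essential_word [tuple z i | i < n.+1].
Proof.
move=> zn oW Ww zw WP; split; first exact: words_code.
have zP := WP _ _ Ww zw zn.
have Sw w' : cell G0 [tuple z i | i < n.+1] w' -> w' = w.
  move=> /cell_coded zw'; apply: nat_point_inj.
  apply: (@coded_eq n.+1 z); [|exact: coded_G|exact: coded_G].
  have := mm_G_point zP (coded_G zw' (ltnSn n)).
  by have := mm_G_point zP (coded_G zw (ltnSn n)) => -> ->.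
apply: (open_by_cells oW) => [w' /Sw ->//|w' Ww' w'z].
have [w01 wG] := nat_point_graph w'.
have [v vn vw'] := finite_trajectory_code hF (fun k _ => w01 k) wG.
have vP := WP _ _ Ww' vw' vn.
exists [tuple v i | i < n.+1]; first by apply/cell_coded; exact: coded_G.
rewrite -subset0 => w'' [/cell_coded vw'' zw'']; have := Sw _ zw''.
move=> E; subst w''; apply: w'z; suff -> : w' = w by apply/cell_coded.
apply: nat_point_inj; apply: (@coded_eq n.+1 v) => //; last exact: coded_G.
by rewrite (mm_G_point vP (vw'' n (ltnSn n))) (mm_G_point vP (coded_G vw' (ltnSn n))).
Qed.

(** * The intervals I_u of coded trajectories *)

Lemma inverse_word_coded n z x : coded G z n x ->
  inverse_word (mkseq z n) (x n) = x 0%N.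
Proof.
elim: n z x => [//|n IH] z x zx; rewrite mkseq_cons /=.
have -> := IH (fun i => z i.+1) (fun i => x i.+1) (fun k => zx k.+1).
have /mm_GP[/clamp_branchE E ->] := zx 0%N (ltn0Sn n).
by rewrite E.
Qed.

Lemma inverse_intervalE n z :
  inverse_interval [tuple z i | i < n.+1] = inverse_word (mkseq z n.+1) @` R' (z n).
Proof.
rewrite mktuple_mkseq /inverse_interval mkseq_cons -mkseq_cons.
have -> // : last (z 0%N) (mkseq (fun i => z i.+1) n) = z n.
have -> : last (z 0%N) (mkseq (fun i => z i.+1) n) = last (z 0%N) (mkseq z n.+1).
  by rewrite mkseq_cons.
by rewrite mkseqS last_rcons.
Qed.

Lemma inverse_interval_coded n z x : coded G z n.+1 x ->
  inverse_interval [tuple z i | i < n.+1] (x 0%N).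
Proof.
move=> zx; rewrite inverse_intervalE.
exists (x n.+1); last exact: inverse_word_coded.
by have /mm_GP[] := zx n (ltnSn n).
Qed.

Lemma inverse_word_D n z t : (forall k, mm_next (z k) (z k.+1)) ->
  R' (z n) t -> D (z 0%N) (inverse_word (mkseq z n.+1) t).
Proof.
elim: n z => [|n IH] z zn tR.
  by rewrite /inverse_word /= -clamp_branchE //; exact: clamp_branch_D.
rewrite mkseq_cons; have := IH (fun i => z i.+1) (fun k => zn k.+1) tR.
move=> /(mm_next_R (zn 0%N)) => tR0.
by rewrite [inverse_word _ _]/= -clamp_branchE //; exact: clamp_branch_D.
Qed.

Lemma inverse_interval_sub01 n z : (forall k, mm_next (z k) (z k.+1)) ->
  inverse_interval [tuple z i | i < n.+1] `<=` `[0, 1]%classic.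
Proof.
move=> zn; rewrite inverse_intervalE => _ [t tR <-].
have := mm_D_sub01 (inverse_word_D zn tR); move: (inverse_word _ _) => s.
by rewrite /= in_itv.
Qed.

Lemma open_nat_point_ball n m (x : nat -> R) (e : R) :
  open [set w : finite_trajectory_space F n.+1 |
    forall k, (k <= m)%N -> `|nat_point w k - x k| < e].
Proof.
have -> : [set w : finite_trajectory_space F n.+1 |
    forall k, (k <= m)%N -> `|nat_point w k - x k| < e] =
  ~` \bigcup_(k in `I_m.+1) [set w | e <= `|nat_point w k - x k|].
  apply/seteqP; split=> [w Hw [k /= km]|w Hw k km].
    by rewrite leNgt Hw.
  by rewrite ltNge; apply/negP => ek; apply: Hw; exists k.
apply: closed_openC; apply: closed_bigcup; first exact: finite_II.
move=> k _; apply: (@preimage_closed _ _ (fun w => nat_point w k)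
  [set y | e <= `|y - x k|]).
  by move=> w _; exact: nat_point_continuous.
rewrite (_ : [set y | _] = ~` [set y | `|y - x k| < e]).
  exact/open_closedC/dist_lt_open.
by apply/seteqP; split=> y /=; rewrite leNgt => /negP.
Qed.

Lemma R0_open a : mm_class a <> Point -> open (R0 a).
Proof.
by rewrite /mm_R0; case: (mm_class a) => // _; exact: interval_open.
Qed.

Lemma orbit_segment_ball z n m (x : nat -> R) (e t0 : R) :
  (forall k, (k <= m)%N -> `|orbit_segment z n t0 k - x k| < e) ->
  \forall t \near t0, forall k, (k <= m)%N -> `|orbit_segment z n t k - x k| < e.
Proof.
move=> Hk.
have : \forall t \near t0, forall k : 'I_m.+1, `|orbit_segment z n t k - x k| < e.
  apply: (@filter_forall _ _ _ _ (nbhs_filter t0)) => k.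
  have nW : nbhs (orbit_segment z n t0 k) [set y | `|y - x k| < e].
    apply: open_nbhs_nbhs; split; first exact: dist_lt_open.
    by apply: Hk; rewrite -ltnS.
  exact: (@orbit_segment_continuous R F z n k t0 _ nW).
by apply: filterS => t Ht k km; exact: (Ht (Ordinal (km : (k < m.+1)%N))).
Qed.

Lemma mm_next_cat u v m : (forall k, mm_next (u k) (u k.+1)) ->
  (forall k, mm_next (v k) (v k.+1)) -> mm_next (u m) (v 0%N) ->
  let z k := if (k <= m)%N then u k else v (k - m.+1)%N in
  forall k, mm_next (z k) (z k.+1).
Proof.
move=> un vn uv z k; rewrite /z; have [km|mk] := ltnP k m.
  by rewrite (ltnW km).
have [km|km] := leqP k m; last by rewrite subSn.
have -> : k = m by lia.
by rewrite subnn.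
Qed.

(* Either U contains a trajectory whose code ends, at some time, with a symbol
   other than a point, and its code is prolonged by a long word of Z chosen
   through a nearby point outside P; or the initial segments of U are isolated
   and their own codes are essential.  All symbols used by Z are essential, as
   they lead back to the initial graph symbol. *)
Lemma open_word (C : set A) (U : set (trajectory_space F)) (x0 : trajectory_space F) :
  coding_condition F -> @essential_symbols R F `<=` C -> open U -> U x0 ->
  exists z n, [/\ forall k, mm_next (z k) (z k.+1),
    forall k, (k <= n)%N -> C (z k) &
    forall x : trajectory_space F, coded G z n.+1 (set_val x) -> U x].
Proof.
move=> [Z [[Zsft _ _] Ztrans Zcode Zlim]] essC [V oV VU] Ux0.
have Vx0 : V (set_val x0) by rewrite -VU in Ux0.
have [m [e e0 Ve]] := ptws_open_ball oV Vx0.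
(* Segments with [m.+2] coordinates have [m.+1] coded steps: [z m] is the last symbol, and
   coordinate [m.+1], left free by the ball, parametrizes the arc. *)
pose W := [set w : finite_trajectory_space F m.+2 |
  forall k, (k <= m)%N -> `|nat_point w k - set_val x0 k| < e].
have oW : open W by exact: open_nat_point_ball.
have [[w [z [Ww zn zw zP]]]|nA] := pselect (exists w z, [/\ W w,
    forall k, mm_next (z k) (z k.+1), coded G0 z m.+1 (nat_point w) &
    mm_class (z m) <> Point]); last first.
  have [w wx] := trajectory_restrict m.+1 x0.
  have [z zn zx] := trajectory_code hF (set_mem (valP x0)).
  have zw : coded G0 z m.+1 (nat_point w).
    by move=> k km; rewrite (wx k (ltnW km)) (wx _ km); exact: zx.
  have Ww : W w by move=> k km; rewrite wx 1?ltnW // subrr normr0.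
  have WP w' v : W w' -> coded G0 v m.+1 (nat_point w') ->
      (forall k, mm_next (v k) (v k.+1)) -> mm_class (v m) = Point.
    by move=> Ww' vw vn; apply: contrapT => vP; apply: nA; exists w', v.
  have ess := essential_word_isolated zn oW Ww zw WP.
  exists z, m; split=> // [k km|x xz].
    apply: essC; exists m.+1, [tuple z i | i < m.+1] => //.
    by rewrite memtE mktuple_mkseq; apply/mapP; exists k => //; rewrite mem_iota.
  rewrite -VU; apply: Ve => k km.
  have zP := WP _ _ Ww zw zn.
  (* The final point symbol [z m] fixes coordinate [m.+1], hence all earlier ones, so [x] agrees
     with [x0] up to time [m]. *)
  have zx' : coded G z m.+1 (set_val x0) by move=> j _; apply: mm_G0_G; exact: zx.
  rewrite (coded_eq _ xz zx') ?subrr ?normr0 // 1?ltnW //.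
  by rewrite (mm_G_point zP (xz m (ltnSn m))) (mm_G_point zP (zx' m (ltnSn m))).
pose y := nat_point w m.+1.
have wE := coded_orbit_segment (coded_G zw).
have yR : R0 (z m) y by have /mm_G0P[] := zw m (ltnSn m).
(* Moving the last coordinate by less than [d] keeps the pulled back segment in the ball around
   [x0]. *)
have /nbhs_ballP[d /= d0 dy] : \forall t \near y, R0 (z m) t /\
    forall k, (k <= m)%N -> `|orbit_segment z m.+1 t k - set_val x0 k| < e.
  apply: filterI.
    by apply: open_nbhs_nbhs; split => //; exact: R0_open.
  by apply: orbit_segment_ball => k km; rewrite -wE 1?ltnW //; exact: Ww.
(* Avoiding P forces the first symbol of the Z-code of [t] to be a graph symbol with [t] in its open
   domain, so it may follow [z m]. *)
have [t tI tP] : exists2 t, y - d < t < y + d &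
    t \notin [seq p i | i <- enum 'I_(mm_r F).+1].
  by apply: avoid_seq; rewrite ltrD2l; lra.
have td : `|y - t| < d by rewrite ltr_norml; lra.
have [tR _] := dy t td.
have tNP : ~ range p t.
  by move=> [i _ it]; move/negP: tP; apply; apply/mapP; exists i => //; rewrite mem_enum.
have t01 := mm_R_sub01 (mm_R0_sub tR).
have [v Zv [x' [x't vx']]] := Zcode t ltac:(by rewrite /= in_itv).
have vn : forall k, mm_next (v k) (v k.+1) by apply/sftP; exact: Zsft.
have tD : D (v 0%N) t by rewrite -x't; exact: mm_G_D (vx' 0%N).
have [v0G tD0] := mm_DP tD tNP.
have zv : mm_next (z m) (v 0%N) := mm_nextI tR tD0.
(* The word is taken so long that its interval, which contains [t], stays within distance [d] of
   [y]. *)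
have [n nlt] : exists n, \big[Num.max/0]_(u : n.+1.-tuple A | `[< words Z u >])
          interval_length (inverse_interval u) < d - `|y - t|.
  have dt : 0 < d - `|y - t| by rewrite subr_gt0.
  have /cvgrPdist_lt/(_ _ dt)[N _ HN] := Zlim.
  exists N; have := HN N.+1 (leqnSn N).
  by rewrite /= sub0r normrN; apply: le_lt_trans; exact: ler_norm.
have wv : words Z [tuple v i | i < n.+1].
  by exists v => //; exists 0%N => i; rewrite tnth_mktuple.
pose zz k := if (k <= m)%N then z k else v (k - m.+1)%N.
exists zz, (m + n.+1)%N; split.
- exact: mm_next_cat.
- move=> k _; apply: essC; rewrite /zz; case: leqP => km.
    exact: essential_symbols_code km zn zP.
  (* Transitivity of Z gives a word from [v j] to [v 0]. Its last symbol is not a point, so all its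
     symbols, [v j] among them, are essential. *)
  set j := (k - m.+1)%N.
  have wj i : words Z [tuple v i].
    by exists v => //; exists i => l; rewrite ord1 tnth0 addn0.
  have [s [l _ [u [v' Zv' [q uv']] us]] [s' [sE lastE]]] := Ztrans _ _ (wj j) (wj 0%N).
  have size_s : l = (size s').+1 by rewrite -(size_tuple u) us sE.
  have nth_s i : (i < l)%N -> nth (v j) s i = v' (q + i)%N.
    move=> il; rewrite -(uv' (Ordinal il)) (tnth_nth (v j)); congr (nth _ _ _); exact/esym.
  have v'n : forall i, mm_next (v' (q + i)%N) (v' (q + i.+1)%N).
    by move=> i; rewrite addnS; move: (q + i)%N; apply/sftP; exact: Zsft.
  have := nth_s 0%N; rewrite size_s sE /= => /(_ isT) E0.
  have := nth_s (size s'); rewrite size_s sE ltnSn => /(_ isT).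
  rewrite -last_nth lastE => El; rewrite E0.
  apply: (@essential_symbols_code (size s') (fun i => v' (q + i)%N) 0%N) => //.
  by rewrite -El v0G.
move=> x xz; rewrite -VU.
have xz1 : coded G z m.+1 (set_val x).
  move=> k km; have zzE : zz k = z k by rewrite /zz (km : (k <= m)%N).
  by rewrite -zzE; apply: xz; rewrite (leq_trans km)// addnS ltnS leqW// leq_addr.
have xz2 : coded G v n.+1 (fun k => set_val x (m.+1 + k)%N).
  move=> k kn; have zzE : zz (m.+1 + k)%N = v k.
    have mk : (m.+1 + k <= m)%N = false by rewrite addSn ltnNge leq_addr.
    by rewrite /zz mk addKn.
  by rewrite addnS -zzE; apply: xz; rewrite -addnS addSn ltnS leq_add2l.
apply: Ve => k km; rewrite (coded_orbit_segment xz1 (ltnW (km : (k < m.+1)%N))).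
apply: (dy _ _).2 => //.
(* Coordinate [m.+1] of [x] and the point [t] start trajectories with the same code, so they lie in
   one interval I_u. *)
have I1 := inverse_interval_coded xz2; rewrite addn0 in I1.
have I2 := inverse_interval_coded (fun k (_ : (k < n.+1)%N) => vx' k); rewrite x't in I2.
have H := interval_length_ge (inverse_interval_sub01 vn) I1 I2.
pose L (u : n.+1.-tuple A) : R := interval_length (inverse_interval u).
have vL : L [tuple v i | i < n.+1] <= \big[Num.max/0]_(u | `[< words Z u >]) L u.
  by apply: le_bigmax_cond; exact/asboolP.
have {}H := le_lt_trans H (le_lt_trans vL nlt).
rewrite /ball /=; apply: le_lt_trans (ler_distD t _ _) _.
by rewrite [X in _ + X]distrC; lra.
Qed.

End Essential.

(** * Mixing and periodic points *)

Section Mixing.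
Variables (R : realType) (F : markov_multimap R).
Hypothesis hF : properly_parametrized F.
Local Notation A := (mm_symbol F).
Local Notation D := (@mm_D R F).
Local Notation G := (@mm_G R F).
Local Notation G0 := (@mm_G0 R F).
Local Notation next := (@mm_next R F).
Local Notation T := (@trajectory_map R F).
Implicit Types (a b c d : A) (z u v : nat -> A).

Lemma iter_trajectory_map n (x : trajectory_space F) k :
  set_val (iter n T x) k = set_val x (n + k)%N.
Proof. by elim: n k => //= n IH k; rewrite addSnnS -IH. Qed.

Lemma trajectory_eq (x y : trajectory_space F) :
  (forall k, set_val x k = set_val y k) -> x = y.
Proof. by move=> xy; apply/val_inj/funext. Qed.

Lemma periodic_trajectory z n : (forall k, next (z k) (z k.+1)) ->
  (0 < n)%N -> z n = z 0%N ->
  exists2 x : trajectory_space F, periodic_points T x & coded G z n (set_val x).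
Proof.
move=> zn n0 z0; have := @orbit_segment_D R F z zn n.
(* Since [z n = z 0], pulling back along the cycle maps the segment [D (z 0)] into itself; a fixed
   point yields an orbit segment that closes up. *)
pose f t := orbit_segment z n t 0; rewrite z0 => /(_ _ 0%N) fD.
have dlr : @mm_p R F (mm_dl (z 0%N)) <= mm_p (mm_dr (z 0%N)).
  have [t /mm_D0_sub] := mm_D0_neq0 (z 0%N).
  by rewrite /mm_D /= in_itv /= => /andP[]; exact: le_trans.
have [t tD ft] : exists2 t, D (z 0%N) t & f t = t.
  have fc : {within `[@mm_p R F (mm_dl (z 0%N)), mm_p (mm_dr (z 0%N))]%classic,
      continuous (fun t => f t - t)}.
    apply: continuous_subspaceT => t.
    by apply: cvgB; [exact: orbit_segment_continuous|exact: cvg_id].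
  (* [f t - t] is nonnegative at the left end and nonpositive at the right end; the two ends may
     coincide. *)
  have [] := @IVT R (fun t => f t - t) _ _ 0 dlr fc.
    have := fD (@mm_p R F (mm_dl (z 0%N))) isT.
    have := fD (@mm_p R F (mm_dr (z 0%N))) isT.
    rewrite /mm_D /= !in_itv /= !lexx dlr => /(_ isT) h1 /(_ isT) h2.
    by rewrite ge_min le_max; apply/andP; split; apply/orP; [right|left];
      rewrite /f ?subr_le0 ?subr_ge0; lra.
  move=> t tI /eqP; rewrite subr_eq0 => /eqP ft; exists t => //.
have sG : coded G z n (orbit_segment z n t).
  by apply: orbit_segment_coded => //; rewrite z0.
(* The values at times [0] and [n] agree, so the step that wraps around is also a step of the
   multi-map. *)
pose x k := orbit_segment z n t (k %% n)%N.
have xE k : (k <= n)%N -> x k = orbit_segment z n t k.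
  rewrite leq_eqVlt => /predU1P[->|kn]; last by rewrite /x modn_small.
  by rewrite /x modnn orbit_segment_last.
have xG k : G (z (k %% n)%N) (x k, x k.+1).
  have kn : (k %% n < n)%N by rewrite ltn_mod.
  have -> : x k.+1 = x (k %% n).+1 by rewrite /x -addn1 -modnDml addn1.
  by rewrite {1}/x xE //; exact: sG.
have xT : trajectories F x by apply/trajectoriesP => k; exists (z (k %% n)%N).
exists (exist _ x (mem_set xT)).
  exists n => //; apply: trajectory_eq => k; rewrite iter_trajectory_map.
  by rewrite !set_valE /= /x modnDl.
by move=> k kn; have := xG k; rewrite modn_small // set_valE.
Qed.

Lemma mkseq_path z n : (forall k, next (z k) (z k.+1)) ->
  path next (z 0%N) (mkseq (fun k => z k.+1) n) /\
  last (z 0%N) (mkseq (fun k => z k.+1) n) = z n.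
Proof.
move=> zn; elim: n => // n [IH1 IH2].
by rewrite mkseqS rcons_path last_rcons IH1 IH2 zn.
Qed.

Lemma mixing_symbols_path (C : set A) : mixing_symbols (@sft R F) C ->
  exists2 N, (0 < N)%N & forall c d, C c -> C d -> forall n, (N <= n)%N ->
    exists s, [/\ size s = n, path next c s & last c s = d].
Proof.
move=> [N N0 HN]; exists N => // c d Cc Cd n Nn.
(* A path with [n] steps is a word of length [n.+1]. *)
have [w [z [zs _] [k zw]] [s [ws sd]]] := HN c d Cc Cd n.+1 (leqW Nn).
exists s; split=> //.
  by have := size_tuple w; rewrite ws => -[].
have /(words_sft_path hF) : words (@sft R F) w by exists z => //; exists k.
by rewrite /thead (tnth_nth c) ws.
Qed.

(** The cycle follows [u] for [m] steps, takes [n - m] steps to reach [v 0] at time [n], follows [v]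
    for [l] steps and returns to [u 0] in [N] steps. The strict bounds on [q] ensure that one period
    codes both words in full. *)
Lemma cycle_through (C : set A) u v m l : mixing_symbols (@sft R F) C ->
  (forall k, next (u k) (u k.+1)) -> (forall k, next (v k) (v k.+1)) ->
  (forall k, (k <= m)%N -> C (u k)) -> (forall k, (k <= l)%N -> C (v k)) ->
  exists N, forall n, (N <= n)%N -> exists z q,
    [/\ forall k, next (z k) (z k.+1), (m < q)%N /\ (n + l < q)%N, z q = z 0%N,
      forall k, (k <= m)%N -> z k = u k &
      forall k, (k <= l)%N -> z (n + k)%N = v k].
Proof.
move=> /mixing_symbols_path[N N0 HN] un vn uC vC; exists (m + N)%N => n mn.
have [s1 [s1n p1 l1]] := HN _ _ (uC m (leqnn m)) (vC 0%N isT) (n - m)%N ltac:(lia).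
have [s2 [s2n p2 l2]] := HN _ _ (vC l (leqnn l)) (uC 0%N isT) N (leqnn N).
have [pu lu] := mkseq_path m un; have [pv lv] := mkseq_path l vn.
set su := mkseq (fun k => u k.+1) m in pu lu.
set sv := mkseq (fun k => v k.+1) l in pv lv.
pose s := (su ++ s1) ++ sv ++ s2.
have ps : path next (u 0%N) s by rewrite !cat_path pu !last_cat lu p1 l1 pv lv p2.
have ls : last (u 0%N) s = u 0%N by rewrite !last_cat lu l1 lv l2.
have size_s : size s = (n + l + N)%N.
  by rewrite !size_cat !size_mkseq s1n s2n; lia.
(* Any admissible continuation will do, because only the values of [z] up to the end of the cycle
   are prescribed. *)
have [|//|z [zn _ zs]] := @path_extend _ next setT (u 0%N) s _ _ ps.
  by move=> c _; have [d cd] := mm_next_exists hF c; exists d.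
exists z, (n + l + N)%N; split=> //; first by split; lia.
- by rewrite !zs ?size_s // -size_s -last_nth ls.
- move=> k km; rewrite zs; last by rewrite size_s; lia.
  have -> : u 0%N :: s = mkseq u m.+1 ++ (s1 ++ sv ++ s2).
    by rewrite mkseq_cons /s -catA.
  by rewrite nth_cat size_mkseq ltnS km nth_mkseq.
- move=> k kl; rewrite zs; last by rewrite size_s; lia.
  rewrite -cat_cons nth_cat /= size_cat size_mkseq s1n.
  have -> : (m + (n - m))%N = n by lia.
  case: k kl => [_|k kl].
    have sn : size (su ++ s1) = n by rewrite size_cat size_mkseq s1n; lia.
    by rewrite addn0 ltnSn -[X in nth _ _ X]sn -last_nth last_cat lu l1.
  have -> : (n + k.+1 < n.+1)%N = false by lia.
  have -> : (n + k.+1 - n.+1)%N = k by lia.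
  by rewrite nth_cat size_mkseq kl nth_mkseq.
Qed.

(** Serves both conclusions: arbitrary [V] gives mixing, and [V = U] gives density of the periodic
    points. *)
Lemma mixing_periodic (C : set A) (U V : set (trajectory_space F)) :
  coding_condition F -> mixing_symbols (@sft R F) C ->
  @essential_symbols R F `<=` C -> open U -> U !=set0 -> open V -> V !=set0 ->
  exists N, forall n, (N <= n)%N -> exists x : trajectory_space F,
    [/\ periodic_points T x, U x & V (iter n T x)].
Proof.
move=> cc mC essC oU [x Ux] oV [y Vy].
have [u [m [un uC uU]]] := open_word hF cc essC oU Ux.
have [v [l [vn vC vV]]] := open_word hF cc essC oV Vy.
have [N HN] := cycle_through mC un vn uC vC.
exists N => n /HN[z [q [zn [mq lq] zq zu zv]]].
have [p pT zp] := periodic_trajectory zn (leq_ltn_trans (leq0n m) mq) zq.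
exists p; split=> //.
  by apply: uU => k km; rewrite -zu //; apply: zp; exact: leq_trans km mq.
apply: vV => k kl; rewrite -zv // !iter_trajectory_map addnS.
by apply: zp; apply: leq_ltn_trans lq; rewrite leq_add2l.
Qed.

(** * From mixing of the trajectory system to (MC) *)

Lemma essential_cell_neq0 n (u : n.-tuple A) : words (@sft R F) u ->
  [set x : trajectory_space F |
    forall k : 'I_n, G0 (tnth u k) (set_val x k, set_val x k.+1)] !=set0.
Proof.
move=> [z /sftP zs [k zu]]; pose v i := z (k + i)%N.
have vn i : next (v i) (v i.+1) by rewrite /v addnS.
(* A point in the open domain of the symbol following the word is pulled back through the word and
   then prolonged forwards. *)
have [t vt] := mm_D0_neq0 (v n).
have vx := orbit_segment_coded0 vn vt.
have [||y yx] := @trajectory_extend R F n (orbit_segment v n t).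
- by rewrite orbit_segment_last; exact: mm_D_sub01 (mm_D0_sub vt).
- by move=> i i_n; exists (v i) => //; apply: mm_G0_G; exact: vx.
exists y => i /=; rewrite zu !yx ?ltn_ord // 1?ltnW //; exact: vx.
Qed.

Lemma path_G0_head a b s : G0 a = G0 b -> path next a s -> path next b s.
Proof. by case: s => //= c s ab /andP[ac ->]; rewrite (mm_next_G0l ab ac). Qed.

Lemma essential_paths a b : topologically_mixing T ->
  @essential_symbols R F a -> @essential_symbols R F b ->
  exists N, forall n, (N <= n)%N ->
    exists s, [/\ size s = n, path next a s & last a s = b].
Proof.
move=> mixT [n [u [wu ou] /tnthP[i ai]]] [m [w [ww ow] /tnthP[j bj]]].
have [N HN] := mixT _ _ (open_trajectory_cell ou) (essential_cell_neq0 wu)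
  (open_trajectory_cell ow) (essential_cell_neq0 ww).
exists (N + j).+1 => -[//|l] lN.
(* With this delay position [j] of [w] occurs exactly [l.+1] steps after position [i] of [u]. The
   code of [x] has the cells of [a] and [b] at these times, and its end symbols are exchanged for
   [a] and [b]. *)
have [y [[x xu xy] yw]] := HN (l.+1 + i - j)%N ltac:(lia).
have [z zn zx] := trajectory_code hF (set_mem (valP x)).
have zi : G0 (z i) = G0 a.
  by rewrite ai; exact: (mm_G0_inj hF (zx i) (xu i)).
have zj : G0 (z (i + l.+1)%N) = G0 b.
  have := yw j; rewrite -xy !iter_trajectory_map addnS.
  have -> : (l.+1 + i - j + j = i + l.+1)%N by lia.
  by move=> xw; rewrite bj; exact: (mm_G0_inj hF (zx (i + l.+1)%N) xw).
have [pz lz] := @mkseq_path (fun k => z (i + k)%N) l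
  (fun k => eq_rect_r (fun q => next _ (z q)) (zn (i + k)%N) (addnS i k)).
rewrite addn0 in pz lz.
exists (rcons (mkseq (fun k => z (i + k.+1)%N) l) b).
rewrite size_rcons size_mkseq last_rcons; split=> //.
apply: path_G0_head zi _; rewrite rcons_path pz lz /=.
by apply: mm_next_G0r zj _; rewrite addnS; exact: zn.
Qed.

(** Paths between essential symbols must stay inside the mixing set, so every symbol lying on such a
    path is included. *)
Definition essential_component : set A := [set c | exists a b,
  [/\ @essential_symbols R F a, @essential_symbols R F b,
    connect next a c & connect next c b]].

(** The path runs from [c] to an essential symbol, then with adjustable length to an essential
    symbol leading to [d], and finally to [d]. *)
Lemma essential_component_paths c d : topologically_mixing T ->
  essential_component c -> essential_component d ->
  exists N, forall n, (N <= n)%N ->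
    exists s, [/\ size s = n, path next c s & last c s = d].
Proof.
move=> mixT [_ [b [_ eb _ /connectP[p cp pb]]]] [a [_ [ea _ /connectP[q aq qd] _]]].
have [N HN] := essential_paths mixT eb ea.
exists (size p + N + size q)%N => n Nn.
have [s [sn bs sa]] := HN (n - size p - size q)%N ltac:(lia).
exists (p ++ s ++ q); rewrite !size_cat !cat_path !last_cat -pb sa cp bs aq sn.
by split=> //; lia.
Qed.

Lemma essential_component_convex c s k : path next c s ->
  essential_component c -> essential_component (last c s) ->
  (k <= size s)%N -> essential_component (nth c (c :: s) k).
Proof.
move=> cs [a [_ [ea _ ac _]]] [_ [b [_ eb _ db]]] ks.
have : nth c (c :: s) k \in c :: s by rewrite mem_nth.
move: (nth _ _ _) => e es.
exists a, b; split=> //.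
  by apply: connect_trans ac _; exact: path_connect cs _ es.
apply: connect_trans db; case/splitPl: es cs => s1 s2 <-.
rewrite cat_path last_cat => /andP[_ p2]; apply/connectP; by exists s2.
Qed.

Lemma essential_component_mixing : topologically_mixing T ->
  mixing_symbols (@sft R F) essential_component.
Proof.
move=> mixT.
have /choice[N HN] (cd : A * A) : exists N, essential_component cd.1 ->
    essential_component cd.2 -> forall n, (N <= n)%N ->
    exists s, [/\ size s = n, path next cd.1 s & last cd.1 s = cd.2].
  have [C1|] := pselect (essential_component cd.1); last by exists 0%N.
  have [C2|] := pselect (essential_component cd.2); last by exists 0%N.
  by have [N HN] := essential_component_paths mixT C1 C2; exists N.
(* A nonempty closed path at [c] supplies a successor inside the component, so words can be
   prolonged to infinite sequences that never leave it. *)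
have succ c : essential_component c ->
    exists2 d, essential_component d & next c d.
  move=> Cc; have [[|d s] [] //= _ cs ls] := HN (c, c) Cc Cc _ (leqnSn _).
  exists d; last by case/andP: cs.
  by apply: (@essential_component_convex c (d :: s) 1) => //=; rewrite ls.
exists (\max_cd N cd).+1 => // c d Cc Cd [//|n] Nn.
have [s [sn cs ls]] := HN (c, d) Cc Cd n (leq_trans (leq_bigmax (c, d)) Nn).
have conv k : (k <= size s)%N -> essential_component (nth c (c :: s) k).
  by apply: essential_component_convex => //; rewrite ls.
have [z [zn zC zs]] := path_extend succ conv cs.
have size_cs : size (c :: s) == n.+1 by rewrite /= sn.
exists (Tuple size_cs); last by exists s.
exists z; first by split; [exact/sftP|].
exists 0%N => i; rewrite add0n zs; first by rewrite (tnth_nth c).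
by rewrite -ltnS sn.
Qed.

(** The alphabet is finite, so a mixing set lies in a maximal one; finite sets of type [{set A}]
    stand in for subsets of [A]. *)
Lemma mixing_component_exists (C : set A) : mixing_symbols (@sft R F) C ->
  exists2 C' : set A, mixing_component (@sft R F) C' & C `<=` C'.
Proof.
move=> mC; pose P (B : {set A}) := `[< mixing_symbols (@sft R F) [set` B] >].
have setK (B : set A) : [set` [set x | x \in B]%SET] = B.
  by apply/seteqP; split=> x /=; rewrite !inE.
have PC : P [set x | x \in C]%SET by apply/asboolP; rewrite setK.
have [B /maxsetP[/asboolP mB maxB] CB] := maxset_exists PC.
exists [set` B]; last by move=> x Cx; apply: (fintype.subsetP CB); rewrite !inE.
split=> // C' mC' BC'; rewrite -(setK C') -(maxB [set x | x \in C']%SET) //.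
  by apply/asboolP; rewrite setK.
by apply/fintype.subsetP => x xB; rewrite !inE; exact: BC'.
Qed.

End Mixing.

Theorem theorem5p2 (R : realType) (F : markov_multimap R)
    (hF : properly_parametrized F) :
  (topologically_mixing (@trajectory_map R F) -> mixing_condition F) /\
  (coding_condition F -> mixing_condition F ->
     topologically_mixing (@trajectory_map R F) /\
     dense (periodic_points (@trajectory_map R F))).
Proof.
split=> [mixT|cc [C [mC _] essC]].
  have [C mC subC] :=
    mixing_component_exists (essential_component_mixing hF mixT).
  exists C => // a ea; apply: subC.
  by exists a, a; split=> //; exact: connect0.
split=> [U V oU U0 oV V0|U U0 oU].
  have [N HN] := mixing_periodic hF cc mC essC oU U0 oV V0.
  exists N => n /HN[x [_ Ux Vx]]; exists (iter n (@trajectory_map R F) x).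
  by split; [exists x|].
have [N HN] := mixing_periodic hF cc mC essC oU U0 oU U0.
by have [x [px Ux _]] := HN N (leqnn N); exists x; split.
Qed.
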